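(* Let $L$ be odd, $1\le L\le N$, and let $u\in\mathbb{Z}$. Consider the one-dimensional OFDM signal $\mathbf{x}=\mathbf{F}_N^H\mathbf{s}$ of length $N$ whose $L$ pilots are placed contiguously on the indices $i_l=i_0+l$, $l=0,\dots,L-1$ (with $0\le i_0\le N-L$), and carry the odd-length Zadoff-Chu sequence $p_{i_l}=e^{-j\frac{\pi u}{L}l(l+1)}$, with i.i.d. random data symbols on the remaining indices, as set out in the context. Define $$g_1(k,q)=\frac{\sin\left[\pi\left(\frac{k}{N}-\frac{uq}{L}\right)(L-q)\right]}{\sin\pi\left(\frac{k}{N}-\frac{uq}{L}\right)},\qquad g_2(k,q)=\frac{\sin\left[\pi\left(\frac{k}{N}-\frac{uq}{L}+\frac{uN}{L}\right)(L-N+q)\right]}{\sin\pi\left(\frac{k}{N}-\frac{uq}{L}+\frac{uN}{L}\right)}.$$ Then for $(k,q)\in\mathbb{Z}_N^2$ the following hold. If $L\leq N/2$: $$\mathbb{E}\left(|\mathcal{X}^{\mathrm{DP}}(k,q)|^2\right)=\begin{cases}N^2\delta_{k,0}+(\kappa-1)(N-L), & \text{if } q=0,\\ g_1^2(k,q)-L+q+N, & \text{if } 1\leq q<L,\\ N, & \text{if } L\leq q\leq N-L,\\ g_2^2(k,q)-L-q+2N, & \text{if } N-L<q<N.\end{cases}$$ If $L>N/2$: $$\mathbb{E}\left(|\mathcal{X}^{\mathrm{DP}}(k,q)|^2\right)=\begin{cases}N^2\delta_{k,0}+(\kappa-1)(N-L), & \text{if } q=0,\\ g_1^2(k,q)-L+q+N,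 & \text{if } 1\leq q\leq N-L,\\ \left[g_1(k,q)+(-1)^{k-uN}g_2(k,q)\right]^2+2N-2L, & \text{if } N-L<q<L,\\ g_2^2(k,q)-L-q+2N, & \text{if } L\leq q<N.\end{cases}$$ When $k=\langle\frac{uqN}{L}\rangle_N$ (zero denominator in $g_1$) or $k=\langle\frac{u(q-N)N}{L}\rangle_N$ (zero denominator in $g_2$), the formulas hold with the corresponding quotient $g_1$ or $g_2$ replaced by its limit value (the limit of the quotient as its argument $\frac{k}{N}-\frac{uq}{L}$, respectively $\frac{k}{N}-\frac{uq}{L}+\frac{uN}{L}$, regarded as a real variable, tends to the integer value in question).
   Context: Let $j$ be the imaginary unit, $\mathbb{Z}_N=\{0,1,\dots,N-1\}$, $\langle\cdot\rangle_N$ reduction modulo $N$ (of a real number into $[0,N)$), $\delta_{a,b}$ the Kronecker delta. Indices start from $0$. $\mathbf{F}_N$ is the normalized DFT matrix with entries $(\mathbf{F}_N)_{m,n}=\frac{1}{\sqrt N}e^{-j2\pi mn/N}$. Signal model. $I\subseteq\mathbb{Z}_N$ is the set of $L$ pilot indices. The symbol vector $\mathbf{s}\in\mathbb{C}^N$ has deterministic pilot entries $s_i=p_i$ for $i\in I$, while the entries $s_i$, $i\notin I$, are i.i.d. random data symbols, each distributed as a complex random variable $d$ with finite fourth moment and $$\mathbb{E}(d)=0,\quad \mathbb{E}(|d|^2)=1,\quad \mathbb{E}(d^2)=0,\quad \mathbb{E}(d|d|^2)=\mathbb{E}(d^*|d|^2)=0.$$ The kurtosis is $\kappa=\mathbb{E}(|d|^4)$.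 Ambiguity function. $\mathbf{R}_{N,k}$ is the cyclic shift, $(\mathbf{R}_{N,k}\mathbf{x})_n=x_{\langle n-k\rangle_N}$, and $\mathbf{\Phi}_{N,q}=\mathrm{Diag}(1,e^{j2\pi q/N},\dots,e^{j2\pi q(N-1)/N})$. The discrete periodic ambiguity function (DP-AF) is $\mathcal{X}^{\mathrm{DP}}(k,q)=\mathbf{x}^H\mathbf{R}_{N,k}^T\mathbf{\Phi}_{N,q}^*\mathbf{x}$ with $\mathbf{x}=\mathbf{F}_N^H\mathbf{s}$, for $(k,q)\in\mathbb{Z}_N^2$. *)

(* Defs.v *)
From HB Require Import structures.
From mathcomp Require Import all_boot all_order all_algebra.
From mathcomp Require Import spectral.
From mathcomp Require Import complex.
From mathcomp Require Import all_classical all_reals all_analysis.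

Set Implicit Arguments.
Unset Strict Implicit.
Unset Printing Implicit Defensive.

Import Order.TTheory GRing.Theory Num.Theory.
Import numFieldNormedType.Exports.

Local Open Scope classical_set_scope.
Local Open Scope ring_scope.
Local Open Scope complex_scope.

Definition cmod (R : realType) (z : R[i]) : R := ComplexField.Normc.normc z.

Definition expi (R : realType) (t : R) : R[i] := cos t +i* sin t.

(* Reduction of a real number modulo N, into [0, N). *)
Definition rmod (R : realType) (x : R) (N : nat) : R :=
  x - N%:R * (Num.floor (x / N%:R))%:~R.

Section Probability.
Context (R : realType) (d : measure_display) (T : measurableType d)
  (P : probability T R).

Definition cpair (X : T -> R[i]) (t : T) : R * R :=
  (complex.Re (X t), complex.Im (X t)).

(* Borel measurability for the identification of the complex plane with R * R. *)
Definition complex_rv (X : T -> R[i]) : Prop := measurable_fun setT (cpair X).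

(* [fine] sends infinite values to 0; this is harmless where it is used, since
   the fourth absolute moment is assumed finite there. *)
Definition cexpect (X : T -> R[i]) : R[i] :=
  fine ('E_P[fun t => complex.Re (X t)])%E
    +i* fine ('E_P[fun t => complex.Im (X t)])%E.

Definition absmoment (n : nat) (X : T -> R[i]) : \bar R :=
  ('E_P[fun t => (cmod (X t) ^+ n)%R])%E.

Definition kurtosis (X : T -> R[i]) : R := fine (absmoment 4 X).

Definition mutually_independent (I : finType) (A : {set I})
    (X : I -> T -> R[i]) : Prop :=
  forall (J : {set I}) (B : I -> set (R * R)),
    J \subset A -> (forall i, measurable (B i)) ->
    P [set t | forall i, i \in J -> B i (cpair (X i) t)]
    = (\prod_(i in J) P (cpair (X i) @^-1` B i))%E.

End Probability.

Definition same_law (R : realType) (d d' : measure_display)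
    (T : measurableType d) (T' : measurableType d')
    (P : probability T R) (Q : probability T' R)
    (X : T -> R[i]) (Y : T' -> R[i]) : Prop :=
  forall B : set (R * R), measurable B ->
    P (cpair X @^-1` B) = Q (cpair Y @^-1` B).

Record data_symbol (R : realType) (d : measure_display) (T : measurableType d)
    (Q : probability T R) (D : T -> R[i]) : Prop := DataSymbol {
  data_rv : complex_rv D ;
  data_moment4 : (absmoment Q 4 D < +oo)%E ;
  data_mean : cexpect Q D = 0 ;
  data_power : absmoment Q 2 D = 1%E ;
  data_pseudo : cexpect Q (fun t => D t ^+ 2) = 0 ;
  data_third : cexpect Q (fun t => D t * (cmod (D t) ^+ 2)%:C) = 0 ;
  data_third_conj : cexpect Q (fun t => (D t)^* * (cmod (D t) ^+ 2)%:C) = 0 }.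

(* D is the generic data symbol; it lives on its own probability space, so that
   its moments make sense even when every index carries a pilot. *)
Record symbol_vector (R : realType) (d d' : measure_display)
    (T : measurableType d) (T' : measurableType d')
    (P : probability T R) (Q : probability T' R) (D : T' -> R[i])
    (N : nat) (I : {set 'I_N}) (p : 'I_N -> R[i])
    (s : T -> 'cV[R[i]]_N) : Prop := SymbolVector {
  symbol_pilot : forall i t, i \in I -> s t i 0 = p i ;
  symbol_rv : forall i, i \notin I -> complex_rv (fun t => s t i 0) ;
  symbol_law : forall i, i \notin I -> same_law P Q (fun t => s t i 0) D ;
  symbol_indep : mutually_independent P (~: I)%SET (fun i t => s t i 0) }.

Section AmbiguityFunction.
Context (R : realType).

Definition dftmx (N : nat) : 'M[R[i]]_N :=
  \matrix_(m < N, n < N)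
    ((Num.sqrt (N%:R : R))^-1%:C * expi (- (2 * pi * m%:R * n%:R / N%:R) : R)).

Definition shiftmx (N : nat) (k : 'I_N) : 'M[R[i]]_N :=
  \matrix_(n < N, m < N) (m%:Z == ((n%:Z - k%:Z) %% N%:Z)%Z)%:R.

Definition phasemx (N : nat) (q : 'I_N) : 'M[R[i]]_N :=
  diag_mx (\row_(n < N) expi (2 * pi * q%:R * n%:R / N%:R : R)).

Definition hermitian_tr (m n : nat) (A : 'M[R[i]]_(m, n)) : 'M[R[i]]_(n, m) :=
  (A ^t*)%sesqui.

Definition dpaf (N : nat) (x : 'cV[R[i]]_N) (k q : 'I_N) : R[i] :=
  (hermitian_tr x *m (shiftmx k)^T *m map_mx (@conjc R) (phasemx q) *m x) 0 0.

Definition ofdm (N : nat) (s : 'cV[R[i]]_N) : 'cV[R[i]]_N :=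
  hermitian_tr (dftmx N) *m s.

Definition contiguous (N i0 L : nat) : {set 'I_N} :=
  [set i : 'I_N | (i0 <= i < i0 + L)%N]%SET.

Definition zadoff_chu (L : nat) (u : int) (l : nat) : R[i] :=
  expi (- (pi * u%:~R / L%:R * (l%:R * (l%:R + 1))) : R).

Definition sinratio (M th : R) : R := sin (pi * th * M) / sin (pi * th).

Definition sinratio_lim (M th : R) : R := lim (sinratio M y @[y --> th^']).

(* For 0 <= k < N, the test on k in g1 and g2 holds exactly when th is an integer,
   i.e. when the denominator of sinratio vanishes (where x / 0 would be 0). *)
Definition g1 (N L : nat) (u : int) (k q : nat) : R :=
  let th := k%:R / N%:R - u%:~R * q%:R / L%:R in
  let M := L%:R - q%:R in
  if k%:R == rmod (u%:~R * q%:R * N%:R / L%:R : R) N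
  then sinratio_lim M th else sinratio M th.

Definition g2 (N L : nat) (u : int) (k q : nat) : R :=
  let th := k%:R / N%:R - u%:~R * q%:R / L%:R + u%:~R * N%:R / L%:R in
  let M := L%:R - N%:R + q%:R in
  if k%:R == rmod (u%:~R * (q%:R - N%:R) * N%:R / L%:R : R) N
  then sinratio_lim M th else sinratio M th.

End AmbiguityFunction.

(* Main.v *)
(** The matrix product collapses, by orthogonality of the characters of Z/N, to
  X(k, q) = sum_m e(mk/N) s_m^* s_(m+q), so E|X|^2 is a double sum of fourth
  order correlations of the symbols.  For q <> 0, two distinct summands are
  uncorrelated unless all four indices are pilots, since the expectation of the
  product then has a factor among E d, E d^*, E d^2, E d^*^2.  Hence
  E|X|^2 = |S|^2 + (number of m such that m or m + q carries data), where S is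
  the pilot part.  On each of the (at most two) runs of m such that m and m + q
  are both pilots, the quadratic phases of the Zadoff-Chu sequence cancel and S
  is a geometric sum, i.e. a phase times a Dirichlet kernel; the two phases
  differ by pi (k - uN) modulo 2 pi.  The Dirichlet kernel, being a finite sum of
  cosines, is continuous, so that it is also the limit of the quotient of sines
  at its singular points.  For q = 0, only the kurtosis of the data enters. *)
From Pilot Require Import Defs.
From HB Require Import structures.
From mathcomp Require Import all_boot all_order all_algebra.
From mathcomp Require Import complex.
From mathcomp Require Import all_classical all_reals all_analysis.
From mathcomp Require Import measurable_realfun ring zify.

Set Implicit Arguments.
Unset Strict Implicit.
Unset Printing Implicit Defensive.

Import Order.TTheory GRing.Theory Num.Theory.
Import numFieldNormedType.Exports.

Local Open Scope ring_scope.
Local Open Scope complex_scope.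

(** * Expectations of products of independent variables *)

Section Independence.
Local Open Scope classical_set_scope.
Local Open Scope ring_scope.
Context (R : realType) (d d' : measure_display) (T : measurableType d)
  (S : measurableType d').

Import HBNNSimple.

(** The hypothesis on indicators extends to simple functions by linearity and to [f] by monotone
    convergence along [nnsfun_approx]. In the application [W] is the product of the other
    independent factors. *)
Lemma ge0_integral_weighted_pushforward
    (mu : {measure set T -> \bar R}) (nu : {measure set S -> \bar R})
    (W : T -> R) (X : T -> S) (f : S -> \bar R) :
  measurable_fun setT W -> (forall t, 0 <= W t) -> measurable_fun setT X ->
  (forall B, measurable B -> (\int[mu]_t (W t * \1_B (X t))%:E)%E = nu B) ->
  measurable_fun setT f -> (forall x, 0 <= f x)%E ->
  (\int[mu]_t ((W t)%:E * f (X t)) = \int[nu]_x f x)%E.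
Proof.
move=> mW W0 mX muW mf f0.
pose h := nnsfun_approx measurableT mf.
have mh n : measurable_fun setT (h n : S -> R) by exact: measurable_funP.
have cvh x : (h n x)%:E @[n --> \oo] --> f x.
  by apply: cvg_nnsfun_approx.
have ndh x : {homo (fun n => h n x) : a b / (a <= b)%N >-> a <= b}.
  by move=> a b ab; exact/lefP/nd_nnsfun_approx.
have -> : (\int[nu]_x f x)%E = lim ((\int[nu]_x (h n x)%:E)%E @[n --> \oo]).
  rewrite -monotone_convergence//.
  - by apply: eq_integral => x _; apply/esym/cvg_lim => //; exact: cvh.
  - by move=> n; exact/measurable_EFinP.
  - by move=> n x _ /=; rewrite lee_fin.
  - by move=> x _ a b ab; rewrite lee_fin; exact: ndh.
have mWh n : measurable_fun setT (fun t => W t * h n (X t)).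
  by apply: measurable_funM => //; exact: measurableT_comp.
have -> : (\int[mu]_t ((W t)%:E * f (X t)))%E =
    lim ((\int[mu]_t (W t * h n (X t))%:E)%E @[n --> \oo]).
  rewrite -monotone_convergence//.
  - apply: eq_integral => t _; apply/esym/cvg_lim => //.
    by under eq_fun do rewrite EFinM; apply: cvgeZl => //; exact: cvh.
  - by move=> n; exact/measurable_EFinP.
  - by move=> n x _ /=; rewrite lee_fin mulr_ge0.
  - by move=> x _ a b ab; rewrite lee_fin ler_wpM2l// ndh.
apply: congr_lim; apply/funext => n.
have hE (x : S) : (h n x)%:E = (\sum_(y \in range (h n))
    (y * \1_(h n @^-1` [set y]) x)%:E)%E by rewrite fimfunE -fsumEFin.
have mB y : measurable (h n @^-1` [set y]) by [].
have mWB y : measurable_fun setT (fun t => W t * \1_(h n @^-1` [set y]) (X t)).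
  by apply: measurable_funM => //; exact: measurableT_comp.
transitivity (\sum_(y \in range (h n)) (y%:E * nu (h n @^-1` [set y])))%E.
  have y0 y : range (h n) y -> 0 <= y by move=> [x _ <-].
  (* Exchanging sum and integral asks for nonnegative summands at every real [y], even outside the
     range; [Num.max y 0] ensures this and equals [y] on the range of [h n]. *)
  transitivity (\int[mu]_t (\sum_(y \in range (h n))
     (Num.max y 0 * (W t * \1_(h n @^-1` [set y]) (X t)))%:E))%E.
    apply: eq_integral => t _; rewrite EFinM hE ge0_mule_fsumr//.
      apply: eq_fsbigr => y /[!inE] hy.
      by rewrite (max_idPl (y0 _ hy)) -EFinM mulrCA.
    by move=> y; exact: nnfun_muleindic_ge0.
  rewrite ge0_integral_fsum//.
  - apply: eq_fsbigr => y /[!inE] hy; rewrite -muW// (max_idPl (y0 _ hy)).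
    under eq_integral do rewrite EFinM.
    rewrite ge0_integralZl//; last by rewrite lee_fin y0.
    + exact/measurable_EFinP.
    + by move=> t _; rewrite lee_fin mulr_ge0// indicE.
  - by move=> y; apply/measurable_EFinP; exact: measurable_funM.
  - by move=> y t _; rewrite lee_fin !mulr_ge0 ?indicE// le_max lexx orbT.
under eq_integral do rewrite hE.
rewrite ge0_integral_fsum//.
- apply: eq_fsbigr => y _; rewrite integralZl_indic_nnsfun// integral_indic//.
  by rewrite setIT.
- by move=> y; apply/measurable_EFinP; exact: measurable_funM.
- by move=> y x _; exact: nnfun_muleindic_ge0.
Qed.

Lemma integral_prod_indep (P : probability T R) (I : finType) (A : {set I})
    (X : I -> T -> S) (f : I -> S -> R) (v : I -> R) :
  (forall i, i \in A -> measurable_fun setT (X i)) ->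
  (forall (J : {set I}) (B : I -> set S), J \subset A ->
    (forall i, measurable (B i)) ->
    P [set t | forall i, i \in J -> B i (X i t)]
      = (\prod_(i in J) P (X i @^-1` B i))%E) ->
  (forall i, measurable_fun setT (f i)) -> (forall i x, 0 <= f i x) ->
  (forall i, i \in A -> (\int[P]_t (f i (X i t))%:E = (v i)%:E)%E) ->
  (\int[P]_t (\prod_(i in A) f i (X i t))%:E = (\prod_(i in A) v i)%:E)%E.
Proof.
move=> mX indep.
(* Independence is the case where all the f i are indicators; they are then
   turned one at a time into arbitrary functions: the integral against a fixed
   product of the other factors is a measure in the factor under change. *)
suff H : forall (r : seq I) (f : I -> S -> R) (v : I -> R),
  (forall i, i \in A -> i \notin r ->
     exists2 B, measurable B & f i = \1_B) ->
  (forall i, measurable_fun setT (f i)) -> (forall i x, 0 <= f i x) ->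
  (forall i, i \in A -> (\int[P]_t (f i (X i t))%:E = (v i)%:E)%E) ->
  (\int[P]_t (\prod_(i in A) f i (X i t))%:E = (\prod_(i in A) v i)%:E)%E.
  by apply: (H (enum I)) => i _; rewrite mem_enum.
move=> {f v}.
elim=> [|n r IH] f v fr mf f0 fv.
  (* With no index left to convert, every factor is an indicator, and the product is the indicator
     of an intersection of events. *)
  have [B BP] : exists B : I -> set S, forall i,
      measurable (B i) /\ (i \in A -> f i = \1_(B i)).
    suff /choice[B ?] : forall i, exists B : set S,
        measurable B /\ (i \in A -> f i = \1_B) by exists B.
    move=> i; have [/fr[//|B]|iA] := boolP (i \in A); first by exists B.
    by exists set0; split.
  have mXB i : i \in A -> measurable (X i @^-1` B i).
    by move=> iA; rewrite -[_ @^-1` _]setTI; apply: mX => //; case: (BP i).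
  have -> : (\prod_(i in A) v i)%:E = (\prod_(i in A) P (X i @^-1` B i))%E.
    rewrite -prodEFin; apply: eq_bigr => i iA; rewrite -fv// (BP i).2//.
    by rewrite -[in RHS](setIT (_ @^-1` _)) -integral_indic//; exact: mXB.
  rewrite -indep//; last by move=> i; case: (BP i).
  set C := [set t | _].
  have mC : measurable C.
    rewrite (_ : C = \bigcap_(i in [set` A]) (X i @^-1` B i))//.
    by apply: fin_bigcap_measurable => // i; exact: mXB.
  rewrite -[in RHS](setIT C) -integral_indic//; apply: eq_integral => t _.
  congr (_%:E); rewrite indicE.
  have [tC|tC] := boolP (t \in C).
    rewrite big1// => i iA; rewrite (BP i).2// indicE.
    by move: tC; rewrite inE => /(_ i iA) BX; rewrite mem_set.
  have [i iA BX] : exists2 i, i \in A & ~ B i (X i t).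
    apply: contrapT => H; move/negP: tC; apply; rewrite inE => i iA.
    by apply: contrapT => BX; apply: H; exists i.
  by rewrite (bigD1 i)//= (BP i).2// indicE memNset// mul0r.
have [nA|nA] := boolP (n \in A); last first.
  apply: (IH f v) => // i iA ir; apply: fr => //.
  by rewrite inE negb_or ir andbT; apply: contra nA => /eqP <-.
have v0 i : i \in A -> 0 <= v i.
  by move=> iA; rewrite -lee_fin -fv//; apply: integral_ge0 => t _; rewrite lee_fin.
pose W t := \prod_(i in A | i != n) f i (X i t).
pose c := \prod_(i in A | i != n) v i.
have c0 : 0 <= c by rewrite /c; apply: prodr_ge0 => i /andP[iA _]; exact: v0.
have mW : measurable_fun setT W.
  rewrite /W; under eq_fun do rewrite -big_filter.
  apply: (@measurable_prod _ _ _ _ _ _ (fun i t => f i (X i t))) => i.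
  by rewrite mem_filter => /andP[/andP[iA _] _]; apply: measurableT_comp => //; exact: mX.
transitivity (\int[P]_t ((W t)%:E * (f n (X n t))%:E))%E.
  by apply: eq_integral => t _; rewrite -EFinM (bigD1 n)//= mulrC.
have mfn : measurable_fun setT (EFin \o f n) by exact/measurable_EFinP.
have fn0 x : (0 <= (EFin \o f n) x)%E by rewrite lee_fin.
have mXn : measurable_fun setT (X n) by exact: mX.
pose Xn : {mfun T >-> S} := HB.pack (X n) (isMeasurableFun.Build _ _ _ _ _ mXn).
(* Weighted by [W], the event [X n] in [B] has integral [c] times its probability, so the measure to
   integrate against is the law of [X n] scaled by [c]. *)
rewrite (@ge0_integral_weighted_pushforward P
   (mscale (NngNum c0) (distribution P Xn)) W (X n) (EFin \o f n))//.
- rewrite ge0_integral_mscale//=.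
  rewrite (ge0_integral_distribution (Xn : {RV P >-> S}))//=.
    by rewrite fv// (bigD1 n)//= EFinM muleC.
  by move=> x _; exact: fn0.
- by move=> t; rewrite /W; apply: prodr_ge0.
- move=> B mB.
  (* Putting an indicator at [n] leaves only the indices of [r] with arbitrary factors, so the
     induction hypothesis applies. *)
  pose f' i := if i == n then \1_B else f i.
  pose v' i := if i == n then fine (P (X n @^-1` B)) else v i.
  have mXB : measurable (X n @^-1` B).
    by rewrite -[_ @^-1` _]setTI; apply: mX.
  transitivity (\int[P]_t (\prod_(i in A) f' i (X i t))%:E)%E.
    apply: eq_integral => t _; rewrite [in RHS](bigD1 n)//= {1}/f' eqxx mulrC.
    congr ((_ * _)%:E); apply: eq_bigr => i /andP[_ /negbTE ni].
    by rewrite /f' ni.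
  rewrite (IH _ v').
  + rewrite (bigD1 n)//= {1}/v' eqxx mulrC EFinM fineK//; last exact: fin_num_measure.
    rewrite /mscale /=; congr (_%:E * _)%E; apply: eq_bigr => i /andP[_ /negbTE ni].
    by rewrite /v' ni.
  + move=> i iA ir; rewrite /f'; case: eqVneq => [_|ni]; first by exists B.
    by apply: fr => //; rewrite inE negb_or ni.
  + by move=> i; rewrite /f'; case: ifP.
  + by move=> i x; rewrite /f'; case: ifP => // _; rewrite indicE.
  + move=> i iA; rewrite /f' /v'; case: eqVneq => [->|ni]; last exact: fv.
    rewrite fineK; last exact: fin_num_measure.
    rewrite -[in RHS](setIT (_ @^-1` _)) -integral_indic//.
Qed.

End Independence.

(** * Linearity of expectations, real and complex *)

Section ComplexExpectation.
Context (R : realType) (d : measure_display) (T : measurableType d)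
  (P : probability T R).

(** Integrability is bundled with the value, so that linearity needs no side conditions and the
    [fine] inside [cexpect] never meets an infinite integral. *)
Definition has_expect (f : T -> R) (v : R) : Prop :=
  P.-integrable setT (EFin \o f) /\ (\int[P]_t (f t)%:E = v%:E)%E.

Definition has_cexpect (Z : T -> R[i]) (v : R[i]) : Prop :=
  has_expect (fun t => complex.Re (Z t)) (complex.Re v) /\
  has_expect (fun t => complex.Im (Z t)) (complex.Im v).

Lemma has_expectD (f g : T -> R) (v w : R) :
  has_expect f v -> has_expect g w -> has_expect (fun t => f t + g t) (v + w).
Proof.
move=> [fi fv] [gi gw]; split.
  exact: (integrableD measurableT fi gi).
by under eq_integral do rewrite EFinD; rewrite integralD// fv gw.
Qed.

Lemma has_expectZ (k : R) (f : T -> R) (v : R) :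
  has_expect f v -> has_expect (fun t => k * f t) (k * v).
Proof.
move=> [fi fv]; split.
  exact: (integrableZl measurableT k fi).
by under eq_integral do rewrite EFinM; rewrite integralZl// fv.
Qed.

Lemma has_expect_ge0 (f : T -> R) (v : R) :
  measurable_fun setT f -> (forall t, 0 <= f t) ->
  (\int[P]_t (f t)%:E = v%:E)%E -> has_expect f v.
Proof.
move=> mf f0 fv; split=> //; apply/integrableP; split; first exact/measurable_EFinP.
by under eq_integral do rewrite /= ger0_norm//; rewrite fv ltry.
Qed.

Lemma has_expect_cst c : has_expect (fun=> c) c.
Proof.
split; first exact: finite_measure_integrable_cst.
by rewrite integral_cst// -[RHS]mule1; congr (_ * _)%E; exact: probability_setT.
Qed.

Lemma has_cexpect_cst c : has_cexpect (fun=> c) c.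
Proof. by split; exact: has_expect_cst. Qed.

Lemma has_cexpectD (Y Z : T -> R[i]) (v w : R[i]) : has_cexpect Y v -> has_cexpect Z w ->
  has_cexpect (fun t => Y t + Z t) (v + w).
Proof.
move=> [Yr Yi] [Zr Zi]; split.
  have := has_expectD Yr Zr.
  by under eq_fun do rewrite -raddfD; rewrite -raddfD.
have := has_expectD Yi Zi.
by under eq_fun do rewrite -raddfD; rewrite -raddfD.
Qed.

Lemma has_cexpectZ (c : R[i]) (Z : T -> R[i]) (v : R[i]) :
  has_cexpect Z v -> has_cexpect (fun t => c * Z t) (c * v).
Proof.
move=> [Zr Zi]; case: c v Zr Zi => [a b] [x y] Zr Zi; split.
  have := has_expectD (has_expectZ a Zr) (has_expectZ (- b) Zi).
  congr has_expect; last by rewrite mulNr.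
  by apply/funext => t; case: (Z t) => p q; rewrite mulNr.
have := has_expectD (has_expectZ a Zi) (has_expectZ b Zr).
congr has_expect.
by apply/funext => t; case: (Z t) => p q.
Qed.

Lemma has_cexpect_sum (I : Type) (r : seq I) (A : pred I) (Z : I -> T -> R[i])
    (v : I -> R[i]) :
  (forall i, A i -> has_cexpect (Z i) (v i)) ->
  has_cexpect (fun t => \sum_(i <- r | A i) Z i t) (\sum_(i <- r | A i) v i).
Proof.
move=> Zv; elim: r => [|i r IH].
  by under eq_fun do rewrite big_nil; rewrite big_nil; exact: has_cexpect_cst.
under eq_fun do rewrite big_cons; rewrite big_cons; case: ifP => // Ai.
by apply: has_cexpectD => //; exact: Zv.
Qed.

Lemma has_cexpect_unique (Z : T -> R[i]) (v w : R[i]) :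
  has_cexpect Z v -> has_cexpect Z w -> v = w.
Proof.
move=> [[_ Zr] [_ Zi]] [[_ Zr'] [_ Zi']].
apply/eqP; rewrite eq_complex -!(inj_eq (@EFin_inj R)).
by rewrite -Zr Zr' -Zi Zi' !eqxx.
Qed.

Lemma has_cexpect_real (f : T -> R) (v : R) :
  has_expect f v -> has_cexpect (fun t => (f t)%:C) v%:C.
Proof. by move=> fv; split => //; exact: has_expect_cst. Qed.

End ComplexExpectation.

(** * Products of independent complex variables *)

Section ComplexParts.
Context (R : realType).

(* [cpart c z] is the positive ([c.2]) or negative part of the real ([c.1]) or
   imaginary part of z; it reduces complex factors to nonnegative ones. *)
Definition cpart (c : bool * bool) (z : R[i]) : R :=
  Num.max ((if c.2 then 1 else -1) * (if c.1 then complex.Re z else complex.Im z)) 0.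

Definition cpart_coef (c : bool * bool) : R[i] :=
  (if c.1 then 1 else 'i) * (if c.2 then 1 else -1).

Lemma cpart_ge0 c z : 0 <= cpart c z.
Proof. by rewrite le_max lexx orbT. Qed.

Lemma sum_cpart z : z = \sum_c cpart_coef c * (cpart c z)%:C.
Proof.
rewrite -(pair_bigA _ (fun a b => cpart_coef (a, b) * (cpart (a, b) z)%:C))/=.
have maxB (x : R) : Num.max x 0 - Num.max (- x) 0 = x.
  case/orP: (le_total 0 x) => x0.
    by rewrite (max_idPl x0) (max_idPr _) ?subr0// oppr_le0.
  by rewrite (max_idPr x0) (max_idPl _) ?opprK ?add0r// oppr_ge0.
rewrite !big_bool /cpart_coef /cpart /= !mul1r !mulr1 !mulrN1 !mulN1r !mulNr.
rewrite -mulrBr -!rmorphB /= !maxB.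
case: z => x y /=; rewrite [LHS]complexE; congr (_ + _ * _).
Qed.

Context (d d' : measure_display) (S : measurableType d').

(** Componentwise form of [complex_rv], to which the real measurability lemmas apply; [complex_rvP]
    gives the equivalence. *)
Definition cmeasurable (f : S -> R[i]) : Prop :=
  measurable_fun setT (fun x => complex.Re (f x)) /\
  measurable_fun setT (fun x => complex.Im (f x)).

Lemma cmeasurable_cpart c (f : S -> R[i]) :
  cmeasurable f -> measurable_fun setT (cpart c \o f).
Proof.
move=> [fr fi]; apply: measurable_maxr => //.
by apply: measurable_funM => //; case: c.1.
Qed.

Lemma cmeasurable_cst c : cmeasurable (fun=> c).
Proof. by []. Qed.

Lemma cmeasurableM (f g : S -> R[i]) : cmeasurable f -> cmeasurable g ->
  cmeasurable (fun x => f x * g x).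
Proof.
move=> [fr fi] [gr gi]; split.
  rewrite (_ : (fun x => _) = (fun x => complex.Re (f x) * complex.Re (g x) -
     complex.Im (f x) * complex.Im (g x))).
    by apply: measurable_funB; apply: measurable_funM.
  by apply/funext => x; case: (f x) => ? ?; case: (g x).
rewrite (_ : (fun x => _) = (fun x => complex.Re (f x) * complex.Im (g x) +
   complex.Im (f x) * complex.Re (g x))).
  by apply: measurable_funD; apply: measurable_funM.
by apply/funext => x; case: (f x) => ? ?; case: (g x).
Qed.

Lemma cmeasurableX (f : S -> R[i]) n : cmeasurable f -> cmeasurable (fun x => f x ^+ n).
Proof.
move=> mf; elim: n => [|n IH]; first exact: cmeasurable_cst.
by under eq_fun do rewrite exprS; exact: cmeasurableM.
Qed.

Lemma cmeasurableJ (f : S -> R[i]) : cmeasurable f -> cmeasurable (fun x => (f x)^*).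
Proof.
move=> [fr fi]; split.
  rewrite (_ : (fun x => _) = (fun x => complex.Re (f x)))//.
  by apply/funext => x; case: (f x).
rewrite (_ : (fun x => _) = (fun x => - complex.Im (f x))).
  exact: measurableT_comp.
by apply/funext => x; case: (f x).
Qed.

Context (T : measurableType d) (P : probability T R).

(** Each part is dominated by the absolute value of the real or imaginary part, hence integrable, so
    [fine] returns the true integral. *)
Lemma has_expect_cpart (c : bool * bool) (Z : T -> R[i]) (v : R[i]) : has_cexpect P Z v ->
  has_expect P (fun t => cpart c (Z t)) (fine (\int[P]_t (cpart c (Z t))%:E)).
Proof.
move=> [[Zr _] [Zi _]].
have mc : measurable_fun setT (fun t => cpart c (Z t)).
  apply: measurable_maxr => //; apply: measurable_funM => //.
  by case: c.1; apply/measurable_EFinP;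
    [exact: (measurable_int _ Zr)|exact: (measurable_int _ Zi)].
apply: has_expect_ge0 => //; first by move=> t; exact: cpart_ge0.
rewrite fineK//; apply: integrable_fin_num => //.
have le_cpart (x : R) b : `|Num.max ((if b then 1 else -1) * x) 0| <= `|x|.
  by case: b; rewrite ?mul1r ?mulN1r ger0_norm ?le_max ?lexx ?orbT// ge_max
    normr_ge0 andbT ?ler_norm// -normrN ler_norm.
apply: (le_integrable measurableT 
  (g := EFin \o (fun t => if c.1 then complex.Re (Z t) else complex.Im (Z t)))).
- exact/measurable_EFinP.
- by move=> t _ /=; rewrite lee_fin; exact: le_cpart.
- by case: c.1.
Qed.

(** Each factor, and each value [v i], splits into the same combination of four nonnegative parts.
    Distributing the products over these sums reduces the claim to [integral_prod_indep], one choice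
    [phi] of parts at a time. *)
Lemma has_cexpect_prod_indep (I : finType) (A : {set I})
    (X : I -> T -> S) (f : I -> S -> R[i]) (v : I -> R[i]) :
  (forall i, i \in A -> measurable_fun setT (X i)) ->
  (forall (J : {set I}) (B : I -> set S), J \subset A ->
    (forall i, measurable (B i)) ->
    P [set t | forall i, i \in J -> B i (X i t)]%classic
      = (\prod_(i in J) P (X i @^-1` B i)%classic)%E) ->
  (forall i, cmeasurable (f i)) ->
  (forall i, i \in A -> has_cexpect P (fun t => f i (X i t)) (v i)) ->
  has_cexpect P (fun t => \prod_(i in A) f i (X i t)) (\prod_(i in A) v i).
Proof.
move=> mX indep mf fv.
pose w i c := fine (\int[P]_t (cpart c (f i (X i t)))%:E).
have vE i : i \in A -> v i = \sum_c cpart_coef c * (w i c)%:C.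
  move=> iA; apply: has_cexpect_unique (fv i iA) _.
  rewrite (_ : (fun t => _) =
      (fun t => \sum_c cpart_coef c * (cpart c (f i (X i t)))%:C)); last first.
    by apply/funext => t; exact: sum_cpart.
  apply: has_cexpect_sum => c _; apply/has_cexpectZ/has_cexpect_real.
  exact: has_expect_cpart (fv i iA).
rewrite (eq_bigr _ vE).
rewrite (_ : (fun t => _) = (fun t => \prod_(i in A)
    \sum_c cpart_coef c * (cpart c (f i (X i t)))%:C)); last first.
  by apply/funext => t; apply: eq_bigr => i _; exact: sum_cpart.
(* The pair [(true, true)] is only the default value of [phi] outside [A]. *)
rewrite (big_distr_big_dep (true, true)).
under eq_fun do rewrite (big_distr_big_dep (true, true)).
apply: has_cexpect_sum => phi _.
under eq_fun do rewrite big_split /=.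
rewrite [X in has_cexpect _ _ X]big_split /=; apply: has_cexpectZ.
under eq_fun do rewrite -rmorph_prod.
rewrite -rmorph_prod; apply: has_cexpect_real.
have mpart i : measurable_fun setT (cpart (phi i) \o f i).
  exact: cmeasurable_cpart.
apply: has_expect_ge0.
- under eq_fun do rewrite -big_filter.
  apply: (@measurable_prod _ _ _ _ _ _ (fun i t => cpart (phi i) (f i (X i t)))) => i.
  rewrite mem_filter => /andP[iA _].
  exact: (measurableT_comp (mpart i) (mX i iA)).
- by move=> t; apply: prodr_ge0 => i _; exact: cpart_ge0.
apply: (integral_prod_indep mX indep mpart).
  by move=> i x; exact: cpart_ge0.
by move=> i iA; have [] := has_expect_cpart (phi i) (fv i iA).
Qed.

End ComplexParts.

(** * Transfer of expectations between variables with the same law *)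

Section Transfer.
Context (R : realType) (d d' : measure_display) (T : measurableType d)
  (T' : measurableType d') (P : probability T R) (Q : probability T' R).

(** Both expectations are integrals of [h] against the image laws, which agree on measurable sets.
    Integrability is carried over first, through the absolute value of [h]. *)
Lemma has_expect_same_law (e : measure_display) (S : measurableType e)
    (X : T -> S) (Y : T' -> S) (h : S -> R) (v : R) :
  measurable_fun setT X -> measurable_fun setT Y -> measurable_fun setT h ->
  (forall B, measurable B -> P (X @^-1` B)%classic = Q (Y @^-1` B)%classic) ->
  has_expect Q (h \o Y) v -> has_expect P (h \o X) v.
Proof.
move=> mX mY mh XY [hi hv].
pose X' : {RV P >-> S} := HB.pack X (isMeasurableFun.Build _ _ _ _ _ mX).
pose Y' : {RV Q >-> S} := HB.pack Y (isMeasurableFun.Build _ _ _ _ _ mY).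
have XYE (f : S -> \bar R) :
    (\int[distribution P X']_x f x = \int[distribution Q Y']_x f x)%E.
  by apply: eq_measure_integral => B mB _; exact: XY.
have mh' : measurable_fun setT (EFin \o h) by exact/measurable_EFinP.
have ih : P.-integrable setT ((EFin \o h) \o X').
  apply/integrableP; split; first exact: measurableT_comp.
  have mah : measurable_fun setT (abse \o (EFin \o h)) by exact: measurableT_comp.
  have <- : (\int[distribution P X']_x `|(h x)%:E| = \int[P]_t `|(h (X t))%:E|)%E.
    by rewrite ge0_integral_distribution.
  by rewrite XYE ge0_integral_distribution//; move/integrableP : hi => [].
split => //.
have := integral_distribution mh' ih.
rewrite -/(comp _ _) => <-.
by rewrite XYE integral_distribution.
Qed.

End Transfer.

(** * Moments of the data symbol *)

(* Without this notation, the arguments of ring operations would be parsed with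
   [Num.conj], which the lemmas on [conjc] do not match. *)
Section Moments.
Local Notation "z ^*" := (conjc z) : ring_scope.
Context (R : realType) (d : measure_display) (T : measurableType d)
  (P : probability T R).

Lemma cmod2E (z : R[i]) : cmod z ^+ 2 = complex.Re z ^+ 2 + complex.Im z ^+ 2.
Proof. by case: z => x y; rewrite /cmod /= sqr_sqrtr// addr_ge0 ?sqr_ge0. Qed.

Lemma cmod_ge0 (z : R[i]) : 0 <= cmod z.
Proof. by case: z => x y; rewrite /cmod sqrtr_ge0. Qed.

Lemma cmodJM (z : R[i]) : z^* * z = (cmod z ^+ 2)%:C.
Proof.
rewrite cmod2E; case: z => x y /=; apply/eqP; rewrite eq_complex /=.
by rewrite mulNr opprK -!expr2 eqxx /= mulNr [y * x]mulrC subrr.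
Qed.

Lemma cmodM (y z : R[i]) : cmod (y * z) = cmod y * cmod z.
Proof. exact: ComplexField.Normc.normcM. Qed.

Lemma cmodX (z : R[i]) n : cmod (z ^+ n) = cmod z ^+ n.
Proof.
elim: n => [|n IH]; last by rewrite !exprS cmodM IH.
by rewrite !expr0 /cmod ComplexField.Normc.normc1.
Qed.

Lemma cmodJ (z : R[i]) : cmod z^* = cmod z.
Proof. by case: z => x y; rewrite /cmod /= sqrrN. Qed.

Lemma ler_Re_cmod (z : R[i]) : `|complex.Re z| <= cmod z.
Proof.
case: z => x y; rewrite /cmod /= -sqrtr_sqr ler_wsqrtr// lerDl sqr_ge0//.
Qed.

Lemma ler_Im_cmod (z : R[i]) : `|complex.Im z| <= cmod z.
Proof.
case: z => x y; rewrite /cmod /= -sqrtr_sqr ler_wsqrtr// lerDr sqr_ge0//.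
Qed.

Lemma cexpectE (Z : T -> R[i]) v : has_cexpect P Z v -> cexpect P Z = v.
Proof.
move=> [[_ Zr] [_ Zi]]; rewrite /cexpect !unlock Zr Zi; by case: v Zr Zi.
Qed.

Lemma has_cexpectJ (Z : T -> R[i]) v : has_cexpect P Z v ->
  has_cexpect P (fun t => (Z t)^*) v^*.
Proof.
case: v => x y [Zr Zi]; split.
  by rewrite (_ : (fun t => _) = (fun t => complex.Re (Z t)))//;
    apply/funext => t; case: (Z t).
have := has_expectZ (-1) Zi; congr has_expect; last by rewrite mulN1r.
by apply/funext => t; case: (Z t) => p q /=; rewrite mulN1r.
Qed.

(** The modulus bounds both components, so a dominating integrable function makes them integrable
    and [cexpect] is then the genuine expectation. *)
Lemma has_cexpect_dominated (Z : T -> R[i]) (g : T -> R) :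
  cmeasurable Z -> P.-integrable setT (EFin \o g) ->
  (forall t, cmod (Z t) <= g t) -> has_cexpect P Z (cexpect P Z).
Proof.
move=> [mr mi] ig Zg; split.
  have Zi : P.-integrable setT (EFin \o (fun t => complex.Re (Z t))).
    apply: le_integrable ig => //; first exact/measurable_EFinP.
    move=> t _ /=; rewrite lee_fin (le_trans (ler_Re_cmod _))//.
    by rewrite (le_trans (Zg t))// ler_norm.
  by split => //; rewrite /= !unlock fineK//; exact: integrable_fin_num Zi.
have Zi : P.-integrable setT (EFin \o (fun t => complex.Im (Z t))).
  apply: le_integrable ig => //; first exact/measurable_EFinP.
  move=> t _ /=; rewrite lee_fin (le_trans (ler_Im_cmod _))//.
  by rewrite (le_trans (Zg t))// ler_norm.
by split => //; rewrite /= !unlock fineK//; exact: integrable_fin_num Zi.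
Qed.

Lemma complex_rvP (Z : T -> R[i]) : complex_rv Z <-> cmeasurable Z.
Proof.
by split=> [/measurable_fun_pairP[]|[mr mi]] //; exact/measurable_fun_pairP.
Qed.

(** A product of symbols and conjugates with possibly repeated indices regroups into one such
    monomial per index, which is the form that independence can factor. *)
Definition monom (a b : nat) (z : R[i]) : R[i] := z^* ^+ a * z ^+ b.

Lemma cmod_monom a b z : cmod (monom a b z) = cmod z ^+ (a + b).
Proof. by rewrite cmodM !cmodX cmodJ exprD. Qed.

Lemma cmeasurable_monom (e : measure_display) (S : measurableType e)
    (Z : S -> R[i]) a b : cmeasurable Z -> cmeasurable (fun t => monom a b (Z t)).
Proof.
move=> mZ; apply: cmeasurableM; apply: cmeasurableX => //.
exact: cmeasurableJ.
Qed.

Context (D : T -> R[i]) (hD : data_symbol P D).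

Let mD : cmeasurable D. Proof. by have [/complex_rvP] := hD. Qed.

Let mcmod2 : measurable_fun setT (fun t => cmod (D t) ^+ 2).
Proof.
under eq_fun do rewrite cmod2E.
by apply: measurable_funD; apply: measurable_funX; case: mD.
Qed.

Let mcmod4 : measurable_fun setT (fun t => cmod (D t) ^+ 4).
Proof.
under eq_fun do rewrite (exprM _ 2 2).
exact: measurable_funX.
Qed.

Lemma data_expect4 : has_expect P (fun t => cmod (D t) ^+ 4) (kurtosis P D).
Proof.
apply: has_expect_ge0 => //; first by move=> t; rewrite exprn_ge0// cmod_ge0.
rewrite /kurtosis /absmoment unlock fineK// ge0_fin_numE.
  by have := data_moment4 hD; rewrite /absmoment unlock.
by apply: integral_ge0 => t _; rewrite lee_fin exprn_ge0// cmod_ge0.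
Qed.

(** For exponents up to 4, the modulus of the monomial is at most 1 when [cmod (D t)] is at most 1,
    and at most its fourth power otherwise; the sum of the two bounds is integrable. *)
Lemma data_monom a b : (a + b <= 4)%N ->
  has_cexpect P (fun t => monom a b (D t)) (cexpect P (fun t => monom a b (D t))).
Proof.
move=> ab4; apply: (has_cexpect_dominated (g := fun t => 1 + cmod (D t) ^+ 4)).
- exact: cmeasurable_monom.
- exact: (has_expectD (has_expect_cst P 1) data_expect4).1.
- move=> t; rewrite cmod_monom; have D0 := cmod_ge0 (D t).
  case/orP: (le_total (cmod (D t)) 1) => D1.
    by rewrite (le_trans (exprn_ile1 _ D0 D1))// lerDl exprn_ge0.
  by rewrite (le_trans (ler_weXn2l D1 ab4))// lerDr.
Qed.

Lemma data_monom11 : has_cexpect P (fun t => monom 1 1 (D t)) 1.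
Proof.
rewrite /monom; under eq_fun do rewrite !expr1 cmodJM.
apply: has_cexpect_real; apply: has_expect_ge0 => //.
  by move=> t; rewrite sqr_ge0.
by have := data_power hD; rewrite /absmoment unlock.
Qed.

Lemma data_monom22 : has_cexpect P (fun t => monom 2 2 (D t)) (kurtosis P D)%:C.
Proof.
rewrite /monom; under eq_fun do rewrite -exprMn cmodJM -rmorphXn -exprM.
exact/has_cexpect_real/data_expect4.
Qed.

Lemma data_monom01 : has_cexpect P (fun t => monom 0 1 (D t)) 0.
Proof.
rewrite -(data_mean hD); have := @data_monom 0 1 isT.
by rewrite /monom; under eq_fun do rewrite expr0 mul1r expr1.
Qed.

Lemma data_monom02 : has_cexpect P (fun t => monom 0 2 (D t)) 0.
Proof.
rewrite -(data_pseudo hD); have := @data_monom 0 2 isT.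
by rewrite /monom; under eq_fun do rewrite expr0 mul1r.
Qed.

Lemma monomJ a b (z : R[i]) : (monom a b z)^* = monom b a z.
Proof. by rewrite /monom rmorphM !rmorphXn /= conjcK mulrC. Qed.

Lemma data_monom10 : has_cexpect P (fun t => monom 1 0 (D t)) 0.
Proof.
have := has_cexpectJ data_monom01; rewrite rmorph0.
by under eq_fun do rewrite monomJ.
Qed.

Lemma data_monom20 : has_cexpect P (fun t => monom 2 0 (D t)) 0.
Proof.
have := has_cexpectJ data_monom02; rewrite rmorph0.
by under eq_fun do rewrite monomJ.
Qed.

Lemma data_monom00 : has_cexpect P (fun t => monom 0 0 (D t)) 1.
Proof.
by rewrite /monom; under eq_fun do rewrite !expr0 mulr1; exact: has_cexpect_cst.
Qed.

End Moments.

(** * Correlations of the symbols *)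

Section Conjugation.
Local Notation "z ^*" := (conjc z) : ring_scope.
Context (R : realType).

Lemma conjcM (x y : R[i]) : (x * y)^* = x^* * y^*.
Proof. exact: (rmorphM (@conjc R)). Qed.

Lemma conjc_sum (J : Type) (r : seq J) (A : pred J) (F : J -> R[i]) :
  (\sum_(j <- r | A j) F j)^* = \sum_(j <- r | A j) (F j)^*.
Proof. exact: (rmorph_sum (@conjc R)). Qed.

End Conjugation.

Section SymbolMoments.
Local Notation "z ^*" := (conjc z) : ring_scope.
Context (R : realType) (d d' : measure_display) (T : measurableType d)
  (T' : measurableType d') (P : probability T R) (Q : probability T' R)
  (D : T' -> R[i]) (n : nat) (I : {set 'I_n.+1}) (p : 'I_n.+1 -> R[i])
  (s : T -> 'cV[R[i]]_n.+1).
Hypotheses (hD : data_symbol Q D) (hs : symbol_vector P Q D I p s).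

(** The pilot factors are constants and come out of the expectation; the data factors separate by
    independence, and each has the law of [D]. *)
Lemma has_cexpect_prod_monom (a b : 'I_n.+1 -> nat) (v : 'I_n.+1 -> R[i]) :
  (forall i, i \in I -> v i = monom (a i) (b i) (p i)) ->
  (forall i, i \notin I -> has_cexpect Q (fun t => monom (a i) (b i) (D t)) (v i)) ->
  has_cexpect P (fun t => \prod_i monom (a i) (b i) (s t i 0)) (\prod_i v i).
Proof.
move=> vI vD.
rewrite (bigID (mem I)) /=; under eq_fun do rewrite (bigID (mem I)) /=.
rewrite (_ : (fun t => _) = fun t => \prod_(i in I) v i *
    \prod_(i | i \notin I) monom (a i) (b i) (s t i 0)); last first.
  apply/funext => t; congr (_ * _); apply: eq_bigr => i iI.
  by rewrite (symbol_pilot hs)// vI.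
apply: has_cexpectZ.
have inA i : (i \notin I) = (i \in (~: I)%SET) by rewrite inE.
under eq_fun do under eq_bigl do rewrite inA.
under eq_bigl do rewrite inA.
pose f i (x : R * R) := monom (a i) (b i) (x.1 +i* x.2).
have mf i : cmeasurable (f i).
  apply: cmeasurable_monom; split => /=.
    exact: measurable_fst.
  exact: measurable_snd.
have fE i t : monom (a i) (b i) (s t i 0) = f i (cpair (fun t => s t i 0) t).
  by rewrite /f /cpair /=; case: (s t i 0).
rewrite (_ : (fun t => _) = fun t => \prod_(i in ~: I)
    f i (cpair (fun t => s t i 0) t)); last first.
  by apply/funext => t; apply: eq_bigr => i _.
apply: (@has_cexpect_prod_indep _ _ _ _ _ _ _ _
  (fun i t => cpair (fun t => s t i 0) t) f) => //.
- by move=> i; rewrite inE => /(symbol_rv hs).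
- by move=> J B JA mB; rewrite (symbol_indep hs JA mB).
move=> i; rewrite inE => iI.
have mX := symbol_rv hs iI; have mY := data_rv hD.
have law := symbol_law hs iI.
have fD : (fun t => monom (a i) (b i) (D t)) = f i \o cpair D.
  by apply/funext => t; rewrite /f /cpair /=; case: (D t).
have := vD i iI; rewrite fD => -[vr vi]; split.
  exact: (has_expect_same_law (h := fun x => complex.Re (f i x)) mX mY (mf i).1 law vr).
exact: (has_expect_same_law (h := fun x => complex.Im (f i x)) mX mY (mf i).2 law vi).
Qed.

Lemma prod_expr_delta (z : 'I_n.+1 -> R[i]) j : \prod_i z i ^+ (i == j) = z j.
Proof.
rewrite (bigD1 j)//= eqxx expr1 big1 ?mulr1// => i /negbTE ->.
by rewrite expr0.
Qed.

(** The exponents count how often [i] occurs among the conjugated and the plain indices, so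
    coincidences among the four indices need no case analysis here. *)
Lemma prod_monom (z : 'I_n.+1 -> R[i]) (j k l m : 'I_n.+1) :
  \prod_i monom ((i == j) + (i == m)) ((i == k) + (i == l)) (z i) =
    (z j)^* * z k * (z l * (z m)^*).
Proof.
transitivity (\prod_i ((z i)^* ^+ (i == j) * (z i)^* ^+ (i == m) *
    (z i ^+ (i == k) * z i ^+ (i == l)))).
  by apply: eq_bigr => i _; rewrite /monom !exprD.
rewrite !big_split /= !prod_expr_delta.
by ring.
Qed.

Hypothesis p1 : forall i, i \in I -> (p i)^* * p i = 1.

Lemma monom_unit a i : i \in I -> monom a a (p i) = 1.
Proof. by move=> iI; rewrite /monom -exprMn p1// expr1n. Qed.

(** If the two summands coincide, every index has equal exponents, 0 or 1, and contributes 1.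
    Otherwise [q != 0] makes each of the four indices occur only conjugated or only plain, once or
    twice; a data symbol among them then contributes a zero moment. *)
Lemma has_cexpect_corr (q m m' : 'I_n.+1) : q != 0 ->
  has_cexpect P
    (fun t => (s t m 0)^* * s t (m + q) 0 * ((s t m' 0)^* * s t (m' + q) 0)^*)
    (if m == m' then 1 else
     if [&& m \in I, m + q \in I, m' \in I & m' + q \in I]
     then (p m)^* * p (m + q) * ((p m')^* * p (m' + q))^* else 0).
Proof.
move=> q0.
pose a (i : 'I_n.+1) := ((i == m) + (i == (m' + q)%R))%N.
pose b (i : 'I_n.+1) := ((i == (m + q)%R) + (i == m'))%N.
pose v i := if i \in I then monom (a i) (b i) (p i)
            else cexpect Q (fun t => monom (a i) (b i) (D t)).
have termE (z : 'I_n.+1 -> R[i]) : (z m)^* * z (m + q) * ((z m')^* * z (m' + q))^* =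
    \prod_i monom (a i) (b i) (z i).
  by rewrite prod_monom conjcM conjcK.
have vP : has_cexpect P (fun t => \prod_i monom (a i) (b i) (s t i 0)) (\prod_i v i).
  apply: has_cexpect_prod_monom => i iI; rewrite /v ?iI// (negbTE iI).
  apply: data_monom => //; rewrite /a /b.
  by do 4 case: eqP => _.
have mqm (j : 'I_n.+1) : (j == j + q) = false.
  by rewrite -[X in X == _]addr0 (inj_eq (addrI _)) eq_sym (negbTE q0).
have mqm' (j : 'I_n.+1) : (j + q == j) = false by rewrite eq_sym mqm.
rewrite (_ : (fun t => _) = (fun t => \prod_i monom (a i) (b i) (s t i 0))); last first.
  by apply/funext => t; rewrite (termE (fun i => s t i 0)).
move: vP; congr (has_cexpect _ _ _).
have v00 i : a i = 0%N -> b i = 0%N -> v i = 1.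
  rewrite /v => -> ->; case: ifP => iI; first by rewrite /monom !expr0 mulr1.
  exact: (cexpectE (data_monom00 Q D)).
case: eqVneq => [mm'|mm'].
  apply: big1 => i _; rewrite /v; subst m'.
  have -> : b i = a i by rewrite /a /b addnC.
  case: ifPn => iI; first exact: monom_unit.
  rewrite /a; have [->|im] := eqVneq i m.
    by rewrite mqm; exact: (cexpectE (data_monom11 hD)).
  case: eqP => _; first exact: (cexpectE (data_monom11 hD)).
  exact: (cexpectE (data_monom00 Q D)).
case: ifPn => [/and4P[mI mqI mI' mqI']|nI].
  (* All four indices are pilots, so at a data index both exponents are 0. *)
  rewrite (termE p); apply: eq_bigr => i _.
  have [iI|iI] := boolP (i \in I); first by rewrite /v iI.
  have ai : a i = 0%N.
    by rewrite /a; do 2 (case: eqP => [E|_]; first by rewrite E ?mI ?mqI' in iI).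
  have bi : b i = 0%N.
    by rewrite /b; do 2 (case: eqP => [E|_]; first by rewrite E ?mI' ?mqI in iI).
  by rewrite v00// ai bi /monom !expr0 mulr1.
have mmq : (m + q == m' + q) = false.
  by apply: contraNF mm' => /eqP /addIr ->.
have v0 i : v i = 0 -> \prod_i v i = 0 by move=> vi; rewrite (bigD1 i)//= vi mul0r.
have [[[v10 v20] v01] v02] := (cexpectE (data_monom10 hD), cexpectE (data_monom20 hD),
  cexpectE (data_monom01 hD), cexpectE (data_monom02 hD)).
(* At least one of the four indices carries data; the first one found supplies the vanishing
   factor. *)
have [mI|mI] := boolP (m \in I); last first.
  apply: (v0 m); rewrite /v (negbTE mI) /a /b eqxx mqm (negbTE mm').
  by case: eqP.
have [mI'|mI'] := boolP (m' \in I); last first.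
  apply: (v0 m'); rewrite /v (negbTE mI') /a /b eqxx mqm eq_sym (negbTE mm').
  by case: eqP.
have [mqI|mqI] := boolP (m + q \in I); last first.
  apply: (v0 (m + q)); rewrite /v (negbTE mqI) /a /b eqxx mqm'.
  by rewrite mmq; case: eqP.
have mqI' : m' + q \notin I by move: nI; rewrite mI mI' mqI.
apply: (v0 (m' + q)); rewrite /v (negbTE mqI') /a /b eqxx mqm'.
by rewrite [_ == m + q]eq_sym mmq; case: eqP.
Qed.

(** The two exponents at an index are always equal. They give 1 except for exponent 2 at a data
    index, which occurs only for [m == m'] and gives the kurtosis. *)
Lemma has_cexpect_corr0 (m m' : 'I_n.+1) :
  has_cexpect P
    (fun t => (s t m 0)^* * s t m 0 * ((s t m' 0)^* * s t m' 0)^*)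
    (if (m == m') && (m \notin I) then (kurtosis Q D)%:C else 1).
Proof.
pose a (i : 'I_n.+1) := ((i == m) + (i == m'))%N.
have termE (z : 'I_n.+1 -> R[i]) : (z m)^* * z m * ((z m')^* * z m')^* =
    \prod_i monom (a i) (a i) (z i).
  by rewrite prod_monom conjcM conjcK.
pose v i := if i \in I then monom (a i) (a i) (p i)
            else cexpect Q (fun t => monom (a i) (a i) (D t)).
rewrite (_ : (fun t => _) = (fun t => \prod_i monom (a i) (a i) (s t i 0))); last first.
  by apply/funext => t; rewrite (termE (fun i => s t i 0)).
have vP : has_cexpect P (fun t => \prod_i monom (a i) (a i) (s t i 0)) (\prod_i v i).
  apply: has_cexpect_prod_monom => i iI; rewrite /v ?iI// (negbTE iI).
  apply: data_monom => //; rewrite /a.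
  by do 2 case: eqP => _.
move: vP; congr (has_cexpect _ _ _).
have v1 i : (a i <= 1)%N || (i \in I) -> v i = 1.
  rewrite /v; case: ifPn => [iI _|_]; first exact: monom_unit.
  rewrite orbF; case: (a i) => [|[|//]] _; first exact: (cexpectE (data_monom00 Q D)).
  exact: (cexpectE (data_monom11 hD)).
case: ifPn => [/andP[/eqP mm' mI]|mI].
  rewrite (bigD1 m)//= big1 ?mulr1.
    rewrite /v (negbTE mI) /a -mm' eqxx; exact: (cexpectE (data_monom22 hD)).
  by move=> i /negbTE im; rewrite v1// /a -mm' im.
apply: big1 => i _; apply: v1; rewrite /a.
have [->|im] := eqVneq i m.
  have [mm'|_ //] := eqVneq m m'.
  by move: mI; rewrite -mm' eqxx negbK /= => ->.
by case: (i == m').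
Qed.

(** The squared modulus is the sum times its conjugate, expanded as a double sum; since it is real,
    the real part of the complex expectation suffices. *)
Lemma has_expect_cmod2_sum (c : 'I_n.+1 -> R[i]) (Z : 'I_n.+1 -> T -> R[i])
    (v : 'I_n.+1 -> 'I_n.+1 -> R[i]) (w : R) :
  (forall m m', has_cexpect P (fun t => Z m t * (Z m' t)^*) (v m m')) ->
  \sum_m \sum_m' c m * (c m')^* * v m m' = w%:C ->
  has_expect P (fun t => cmod (\sum_m c m * Z m t) ^+ 2) w.
Proof.
move=> Zv vw.
have : has_cexpect P (fun t => \sum_m \sum_m' c m * (c m')^* * (Z m t * (Z m' t)^*)) w%:C.
  rewrite -vw; apply: has_cexpect_sum => m _; apply: has_cexpect_sum => m' _.
  exact: has_cexpectZ.
move=> [+ _]; congr has_expect; apply/funext => t.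
rewrite -[RHS]/(complex.Re (_ ^+ 2)%:C) -cmodJM; congr complex.Re.
rewrite mulrC conjc_sum big_distrl; apply: eq_bigr => m _ /=.
rewrite big_distrr; apply: eq_bigr => m' _ /=.
by rewrite conjcM mulrACA.
Qed.

End SymbolMoments.

(** * Mean power of a weighted sum of symbol products *)

Section AmbiguityPower.
Local Notation "z ^*" := (conjc z) : ring_scope.
Context (R : realType) (d d' : measure_display) (T : measurableType d)
  (T' : measurableType d') (P : probability T R) (Q : probability T' R)
  (D : T' -> R[i]) (n : nat) (I : {set 'I_n.+1}) (p : 'I_n.+1 -> R[i])
  (s : T -> 'cV[R[i]]_n.+1) (c : 'I_n.+1 -> R[i]).
Hypotheses (hD : data_symbol Q D) (hs : symbol_vector P Q D I p s).
Hypotheses (p1 : forall i, i \in I -> (p i)^* * p i = 1).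
Hypotheses (c1 : forall i, (c i)^* * c i = 1).

Lemma sum_notin (B : {set 'I_n.+1}) :
  \sum_m (m \notin B)%:R = n.+1%:R - #|B|%:R :> R[i].
Proof.
transitivity (\sum_m (1 - (m \in B)%:R : R[i])).
  by apply: eq_bigr => m _; case: (m \in B); rewrite ?subrr ?subr0.
rewrite sumrB sumr_const card_ord; congr (_ - _).
by rewrite -natr_sum -sum1_card [in RHS]big_mkcond.
Qed.

(** Every diagonal term is 1, and off the diagonal only pairs inside [B] correlate. The diagonal
    terms in [B] complete the double sum to the squared modulus of the pilot part, and those outside
    [B] are counted separately. *)
Lemma has_expect_power (q : 'I_n.+1) (B : {set 'I_n.+1}) : q != 0 ->
  (forall m, (m \in B) = (m \in I) && (m + q \in I)) ->
  has_expect P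
    (fun t => cmod (\sum_m c m * ((s t m 0)^* * s t (m + q) 0)) ^+ 2)
    (cmod (\sum_(m in B) c m * ((p m)^* * p (m + q))) ^+ 2 + (n.+1%:R - #|B|%:R)).
Proof.
move=> q0 BE.
apply: (has_expect_cmod2_sum (fun m m' => has_cexpect_corr hD hs p1 m m' q0)).
pose y m := c m * ((p m)^* * p (m + q)).
(* Unimodular summands: the diagonal of the pilot double sum is exactly the 1 supplied by the
   correlation. *)
have y1 m : m \in B -> y m * (y m)^* = 1.
  rewrite BE => /andP[mI mqI]; rewrite /y !conjcM conjcK.
  have -> : c m * ((p m)^* * p (m + q)) * ((c m)^* * (p m * (p (m + q))^*)) =
    (c m)^* * c m * ((p m)^* * p m) * ((p (m + q))^* * p (m + q)) by ring.
  by rewrite c1 !p1// !mulr1.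
transitivity (\sum_m ((m \notin B)%:R +
    \sum_(m' in B) (if m \in B then y m * (y m')^* else 0))).
  apply: eq_bigr => m _; rewrite (bigD1 m)//= eqxx mulr1 [_ * _^*]mulrC c1.
  have [mB|mB] /= := boolP (m \in B); last first.
    rewrite big1 ?big1 ?addr0// => m' mm'.
    rewrite eq_sym (negbTE mm'); case: ifPn => [/and4P[mI mqI _ _]|_];
      last by rewrite mulr0.
    by rewrite BE mI mqI in mB.
  rewrite add0r [in RHS](bigD1 m)//= y1//; congr (_ + _).
  rewrite [LHS](bigID (mem B)) /= [X in _ + X]big1 ?addr0; last first.
    move=> m' /andP[mm' mB']; rewrite eq_sym (negbTE mm').
    by case: ifPn => [/and4P[_ _ mI mqI]|_]; [rewrite BE mI mqI in mB'|rewrite mulr0].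
  apply: eq_big => [m'|m' /andP[mm' mB']]; first by rewrite andbC.
  rewrite eq_sym (negbTE mm') andbA -BE mB -BE mB' /= /y !conjcM conjcK.
  by ring.
rewrite big_split /= addrC rmorphD /=; congr (_ + _).
  rewrite -cmodJM conjc_sum mulrC big_distrl /= [LHS](bigID (mem B)) /=.
  rewrite [X in _ + X]big1 ?addr0.
    apply: eq_bigr => m mB; rewrite big_distrr /=; apply: eq_bigr => m' _.
    by rewrite mB.
  by move=> m mB; rewrite (negbTE mB) big1.
by rewrite sum_notin rmorphB !rmorph_nat.
Qed.

(** All correlations equal 1, which yields the squared modulus of the sum of the weights, apart from
    an excess of kurtosis minus 1 on the diagonal at each data index. *)
Lemma has_expect_power0 :
  has_expect P
    (fun t => cmod (\sum_m c m * ((s t m 0)^* * s t m 0)) ^+ 2)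
    (cmod (\sum_m c m) ^+ 2 + (kurtosis Q D - 1) * (n.+1%:R - #|I|%:R)).
Proof.
apply: (has_expect_cmod2_sum (fun m m' => has_cexpect_corr0 hD hs p1 m m')).
transitivity (\sum_m (\sum_m' c m * (c m')^* +
    (m \notin I)%:R * (kurtosis Q D - 1)%:C)).
  apply: eq_bigr => m _; rewrite (bigD1 m)//= [in RHS](bigD1 m)//= eqxx /=.
  under eq_bigr => m' /negbTE mm' do rewrite eq_sym mm' /= mulr1.
  rewrite (_ : (if _ then _ else _) = 1 + (m \notin I)%:R * (kurtosis Q D - 1)%:C).
    by rewrite [c m * (c m)^*]mulrC c1 mul1r addrAC.
  by rewrite rmorphB; case: (m \in I); rewrite ?mul0r ?addr0// mul1r addrC subrK.
rewrite big_split /= [RHS]rmorphD /=; congr (_ + _).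
  by rewrite -cmodJM conjc_sum mulrC big_distrl /=; apply: eq_bigr => m _; rewrite big_distrr.
rewrite -big_distrl /= mulrC [RHS]rmorphM; congr (_ * _).
by rewrite sum_notin rmorphB !rmorph_nat.
Qed.

End AmbiguityPower.

(** * Dirichlet kernel *)

Section Trigonometry.
Context (R : realType).
Local Notation "z ^*" := (conjc z) : ring_scope.
Implicit Types x y th : R.

Lemma expiD x y : expi (x + y) = expi x * expi y.
Proof.
rewrite /expi cosD sinD; apply/eqP; rewrite eq_complex /= eqxx /=.
by rewrite addrC eqxx.
Qed.

Lemma expiN x : expi (- x) = (expi x)^*.
Proof. by rewrite /expi cosN sinN. Qed.

Lemma expi0 : expi 0 = 1 :> R[i].
Proof. by rewrite /expi cos0 sin0. Qed.

Lemma cmod_expi x : cmod (expi x) = 1.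
Proof. by rewrite /cmod /= cos2Dsin2 sqrtr1. Qed.

Lemma expiJM x : (expi x)^* * expi x = 1.
Proof. by rewrite -expiN -expiD addNr expi0. Qed.

Lemma expi_pi_nat (m : nat) : expi (pi * m%:R) = (-1) ^+ m :> R[i].
Proof.
elim: m => [|m IH]; first by rewrite mulr0 expi0 expr0.
rewrite -natr1 mulrDr mulr1 expiD IH exprSr; congr (_ * _).
by rewrite /expi cospi sinpi; apply/eqP; rewrite eq_complex /= oppr0 !eqxx.
Qed.

Lemma expi_pi_int (z : int) : expi (pi * z%:~R) = (-1) ^ z :> R[i].
Proof.
case: z => m; first by rewrite -pmulrn expi_pi_nat.
rewrite NegzE rmorphN /= mulrN expiN -pmulrn expi_pi_nat.
by rewrite -exprnN -exprVn invrN1 (rmorphXn (@conjc R)) (rmorphN1 (@conjc R)).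
Qed.

Lemma expi_2pi_int (z : int) : expi (2 * pi * z%:~R) = 1 :> R[i].
Proof.
rewrite (_ : 2 * pi * z%:~R = pi * z%:~R + pi * z%:~R); last by ring.
by rewrite expiD expi_pi_int -expfzMl mulrNN mulr1 exp1rz.
Qed.

Lemma exprN1z_cases (z : int) : (-1) ^ z = 1 :> R[i] \/ (-1) ^ z = -1 :> R[i].
Proof.
have N1_cases m : (-1) ^+ m = 1 :> R[i] \/ (-1) ^+ m = -1 :> R[i].
  by rewrite -signr_odd; case: odd; [right|left].
by case: z => m; rewrite ?NegzE -?exprnN -?exprVn ?invrN1; exact: N1_cases.
Qed.

(** Subtracting the floor of [y] changes the sine only by a sign, whereas the sine is positive
    strictly between 0 and [pi]; hence the fractional part vanishes. *)
Lemma sin_pi_eq0 y : sin (pi * y) = 0 -> exists z : int, y = z%:~R.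
Proof.
move=> sy; exists (Num.floor y).
set f := (Num.floor y)%:~R : R.
have /andP[fy yf1] := floor_itv y.
rewrite -/f in fy yf1.
apply/eqP; rewrite eq_le; apply/andP; split => //.
rewrite leNgt; apply/negP => fy'.
have : 0 < sin (pi * (y - f)).
  apply: sin_gt0_pi; rewrite mulr_gt0 ?pi_gt0 ?subr_gt0//=.
  rewrite -[ltRHS]mulr1 ltr_pM2l ?pi_gt0// ltrBlDr addrC.
  by move: yf1; rewrite intrD.
have : expi (pi * (y - f)) = expi (pi * y) * (expi (pi * f))^*.
  by rewrite mulrBr expiD expiN.
rewrite expi_pi_int.
have [->|->] := exprN1z_cases (Num.floor y).
- rewrite (rmorph1 (@conjc R)) mulr1 => -[_ ->]; by rewrite sy ltxx.
- rewrite (rmorphN1 (@conjc R)) mulrN1 => -[_ ->]; by rewrite sy oppr0 ltxx.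
Qed.

(** The quotient of [sin (pi * th * M)] by [sin (pi * th)], written without division over
    frequencies symmetric about 0; it thus makes sense at integer [th] too. *)
Definition dirichlet (M : nat) th : R :=
  \sum_(l < M) cos (pi * th * (2 * l%:R + 1 - M%:R)).

(** Twice [sin x * cos (b * x)] is [sin ((b + 1) * x) - sin ((b - 1) * x)], so the sum
    telescopes. *)
Lemma sin_dirichlet M th :
  sin (pi * th * M%:R) = sin (pi * th) * dirichlet M th.
Proof.
pose v (l : nat) := sin (pi * th * (2 * l%:R - M%:R)).
apply: (@mulfI _ 2); first by rewrite pnatr_eq0.
rewrite /dirichlet mulrA big_distrr /=.
transitivity (\sum_(0 <= l < M) (v l.+1 - v l)).
  rewrite telescope_sumr// /v mulr0 sub0r mulrN sinN opprK.
  rewrite (_ : 2 * M%:R - M%:R = M%:R); last by ring.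
  by rewrite mulr_natl mulr2n.
rewrite big_mkord; apply: eq_bigr => l _.
rewrite /v (_ : 2 * l.+1%:R - M%:R = (2 * l%:R + 1 - M%:R) + 1); last by rewrite -natr1; ring.
rewrite (_ : 2 * l%:R - M%:R = (2 * l%:R + 1 - M%:R) - 1); last by ring.
move: (2 * _ + 1 - _) => b; rewrite mulrDr mulrBr mulr1 sinD sinB.
by ring.
Qed.

(** Factoring out the mean phase centres the frequencies at 0; the reflection of the index range
    then cancels the sines and leaves the cosines. *)
Lemma sum_expi M th : \sum_(l < M) expi (2 * pi * th * l%:R) =
  expi (pi * th * (M%:R - 1)) * (dirichlet M th)%:C.
Proof.
pose b (l : 'I_M) := pi * th * (2 * l%:R + 1 - M%:R).
have -> : (dirichlet M th)%:C = \sum_l expi (b l).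
  have s0 : \sum_l sin (b l) = 0.
    have : \sum_l sin (b l) = - \sum_l sin (b l).
      rewrite [LHS](reindex_inj rev_ord_inj) /= -sumrN; apply: eq_bigr => l _.
      rewrite -sinN; congr sin; rewrite /b /=.
      by rewrite natrB ?ltn_ord// -natr1; ring.
    by move/eqP; rewrite -addr_eq0 -mulr2n mulrn_eq0 => /eqP.
  rewrite /dirichlet -/b; apply/eqP; rewrite eq_complex.
  by rewrite !raddf_sum /= s0 eqxx /= big1.
rewrite big_distrr /=; apply: eq_bigr => l _; rewrite -expiD; congr expi.
by rewrite /b; ring.
Qed.

Lemma sinratioE M th : sin (pi * th) != 0 -> sinratio M%:R th = dirichlet M th.
Proof. by move=> s0; rewrite /sinratio sin_dirichlet mulrC mulKf. Qed.

(** Near an integer, but not at it, the quotient equals the continuous function [dirichlet M]. *)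
Lemma sinratio_limE M (z : int) : sinratio_lim M%:R (z%:~R : R) = dirichlet M z%:~R.
Proof.
rewrite /sinratio_lim; apply/cvg_lim => //.
have cont : {for (z%:~R : R), continuous (dirichlet M)}.
  rewrite /continuous_at /dirichlet; apply: cvg_big => [|l _]; first exact: add_continuous.
    apply: continuous_cvg; first exact: continuous_cos.
    apply: cvgMl; apply: cvgMr; exact: cvg_id.
move/continuous_withinNx : cont; apply: cvg_trans; apply: near_eq_cvg.
near=> y; apply/esym/sinratioE/eqP => /sin_pi_eq0[z' yE].
have yz : y != z%:~R by near: y; exact: nbhs_dnbhs_neq.
(* Within distance 1 of [z] there is no other integer, so the denominator does not vanish there. *)
have : `|z%:~R - y| < 1.
  near: y; apply: nbhs_dnbhs; exact: nbhsx_ballx.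
rewrite yE -intrB -intr_norm ltrz1 => zz1.
have : z - z' == 0 by move: zz1; case: (z - z') => [[|m]|m].
by rewrite subr_eq0 => /eqP zz; rewrite yE zz eqxx in yz.
Unshelve. all: by end_near.
Qed.

(** Turns the test in [g1] and [g2] into integrality of their argument. Conversely, if [x / N] is
    [k / N - z], then its floor is [- z] because [k / N] lies in [0, 1). *)
Lemma natr_eq_rmod (N k : nat) x : (k < N)%N ->
  (k%:R == rmod x N) <-> exists z : int, k%:R / N%:R - x / N%:R = z%:~R.
Proof.
move=> kN; have N0 : (0 < N%:R :> R) by rewrite ltr0n (leq_ltn_trans _ kN).
split=> [/eqP ->|[z zE]].
  exists (- Num.floor (x / N%:R)); rewrite /rmod rmorphN /=.
  by field; rewrite gt_eqF.
have xE : x / N%:R = k%:R / N%:R - z%:~R by rewrite -zE; ring.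
have -> : rmod x N = x + N%:R * z%:~R.
  rewrite /rmod xE (_ : Num.floor _ = - z) ?rmorphN ?mulrN ?opprK//.
  apply: floor_def; apply/andP; split.
    by rewrite rmorphN /= lerDr mulr_ge0 ?invr_ge0// ltW.
  by rewrite intrD rmorphN /= [ltRHS]addrC ltrD2r ltr_pdivrMr// mul1r ltr_nat.
apply/eqP; move: zE => /(congr1 (fun y => N%:R * y)).
rewrite mulrBr ![N%:R * (_ / _)]mulrC !divfK ?gt_eqF// => <-.
by ring.
Qed.

End Trigonometry.

(** * Ambiguity function of an OFDM signal *)

Section AmbiguityFormula.
Context (R : realType) (n : nat).
Local Notation "z ^*" := (conjc z) : ring_scope.
Local Notation N := n.+1.

Definition echar (a b : 'I_N) : R[i] := expi (2 * pi * a%:R * b%:R / N%:R : R).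

Lemma echarC a b : echar a b = echar b a.
Proof. by rewrite /echar; congr expi; ring. Qed.

Lemma echarD a b c : echar (a + b) c = echar a c * echar b c.
Proof.
rewrite /echar -expiD.
(* Addition in ['I_N] wraps around; the multiple of [N] removed becomes a multiple of [2 * pi] in
   the exponent. *)
have -> : ((a + b)%R : nat)%:R = a%:R + b%:R - ((a + b) %/ N)%N%:R * N%:R :> R.
  rewrite -natrD [X in X%:R - _](divn_eq (a + b) N) natrD natrM /=.
  by rewrite addrAC subrr add0r.
rewrite (_ : 2 * pi * _ * c%:R / N%:R =
  (2 * pi * a%:R * c%:R / N%:R + 2 * pi * b%:R * c%:R / N%:R)
  + 2 * pi * (- ((a + b) %/ N * c)%N%:Z)%:~R).
  by rewrite [LHS]expiD expi_2pi_int mulr1.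
rewrite rmorphN /= -pmulrn natrM; field.
by rewrite ?natr1 ?nat1r pnatr_eq0.
Qed.

Lemma echarN a b : echar (- a) b = (echar a b)^*.
Proof.
have e0 : echar 0 b = 1 by rewrite /echar mulr0 !mul0r expi0.
have := echarD a (- a) b; rewrite subrr e0 => /esym e1.
by rewrite -[LHS]mul1r -(expiJM (2 * pi * a%:R * b%:R / N%:R)) -mulrA e1 mulr1.
Qed.

(** Translating the summation index by [c] multiplies the sum by [echar a c]. For nonzero [a], the
    choice of 1 for [c] gives a factor other than 1, so the sum vanishes. *)
Lemma sum_echar a : \sum_b echar a b = N%:R * (a == 0)%:R.
Proof.
have [->|a0] := eqVneq a 0.
  rewrite mulr1 (eq_bigr (fun=> 1)) ?sumr_const ?card_ord// => b _.
  by rewrite /echar mulr0 !mul0r expi0.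
rewrite mulr0.
have inv c : echar a c * \sum_b echar a b = \sum_b echar a b.
  rewrite [RHS](reindex_inj (addrI c)) /= big_distrr /=; apply: eq_bigr => b _.
  by rewrite ![echar a _]echarC echarD.
have a1 : (0 < a)%N by rewrite lt0n.
have n1 : (1 < N)%N by apply: leq_ltn_trans a1 (ltn_ord a).
have := inv (Ordinal n1); set e := echar _ _.
have [e1 _|e1 /eqP] := eqVneq e 1; last first.
  by rewrite -subr_eq0 -[X in _ - X]mul1r -mulrBl mulf_eq0 subr_eq0 (negbTE e1) => /eqP.
(* If the factor were 1, the double-angle formula would give [sin (pi * (a / N)) = 0], impossible
   for [a / N] strictly between 0 and 1. *)
have cos1 : cos (2 * (pi * (a%:R / N%:R))) = 1 :> R.
  transitivity (complex.Re e); last by rewrite e1.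
  by rewrite /e /echar /=; congr cos; rewrite mulr1 !mulrA.
have /sin_pi_eq0[z zE] : sin (pi * (a%:R / N%:R)) = 0 :> R.
  move: cos1; rewrite mulr_natl cos_mulr2n cos2sin2 => h.
  apply/eqP; rewrite -sqrf_eq0; apply/eqP; apply: (@mulfI _ 2); first by rewrite pnatr_eq0.
  by rewrite mulr0 -[RHS](subrr 1) -[X in _ = _ - X]h; ring.
have a_lt : a%:R / N%:R < 1 :> R by rewrite ltr_pdivrMr ?ltr0n// mul1r ltr_nat.
have a_gt : 0 < a%:R / N%:R :> R by rewrite divr_gt0 ?ltr0n.
by move: a_lt a_gt; rewrite zE ltrz1 ltr0z; case: z {zE} => [[|m]|m].
Qed.

Lemma shiftmxE (k a b : 'I_N) : shiftmx R k a b = (b == a - k)%:R.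
Proof.
rewrite mxE; congr (nat_of_bool _)%:R.
have {1}-> : b%:Z = (b%:Z %% N%:Z)%Z by rewrite modz_nat modn_small.
rewrite -(eqz_modDr k%:Z) subrK -PoszD !modz_nat eqz_nat [(a %% _)%N]modn_small//.
by rewrite [RHS]eq_sym subr_eq eq_sym -val_eqE.
Qed.

Lemma ofdmE (z : 'cV[R[i]]_N) a :
  ofdm z a 0 = (Num.sqrt (N%:R : R))^-1%:C * \sum_m echar m a * z m 0.
Proof.
rewrite mxE big_distrr /=; apply: eq_bigr => m _.
rewrite !mxE mulrA; congr (_ * _).
rewrite [LHS]conjcM -expiN opprK; congr (_ * _).
by rewrite /= oppr0.
Qed.

(** Once both transforms are expanded, the time index [a] enters only through
    [echar (m' - m - q) a]. Summing over [a] selects [m' = m + q] and yields a factor [N] that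
    cancels the two normalizations. *)
Lemma dpaf_ofdm (z : 'cV[R[i]]_N) (k q : 'I_N) :
  dpaf (ofdm z) k q = \sum_m echar m k * ((z m 0)^* * z (m + q) 0).
Proof.
set x := ofdm z.
have -> : dpaf x k q = \sum_a (x (a - k) 0)^* * (echar q a)^* * x a 0.
  have HE a : (hermitian_tr x *m (shiftmx R k)^T) 0 a = (x (a - k) 0)^*.
    rewrite mxE (bigD1 (a - k)) //= big1 ?addr0 => [|b ba].
      by rewrite [(shiftmx R k)^T _ _]mxE shiftmxE eqxx mulr1 !mxE.
    by rewrite [(shiftmx R k)^T _ _]mxE shiftmxE (negbTE ba) mulr0.
  rewrite /dpaf mxE; apply: eq_bigr => a _; congr (_ * _).
  by rewrite map_diag_mx mul_mx_diag mxE HE !mxE.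
set c0 := (Num.sqrt (N%:R : R))^-1%:C.
have c0J : c0^* = c0 by rewrite conjc_real.
have c0N : c0 * c0 * N%:R = 1.
  rewrite /c0 -rmorphM /= -invfM -expr2 sqr_sqrtr ?ler0n//.
  by rewrite -(rmorph_nat (real_complex R)) -rmorphM /= mulVf ?pnatr_eq0.
transitivity (\sum_a \sum_m \sum_m'
    c0 * c0 * ((z m 0)^* * z m' 0) * echar m k * echar (m' - m - q) a).
  apply: eq_bigr => a _.
  have e3 m m' : echar (m' - m - q) a = echar m' a * (echar m a)^* * (echar q a)^*.
    by rewrite 2!echarD !echarN.
  have ek m : (echar m (a - k))^* = (echar m a)^* * echar m k.
    by rewrite echarC echarD echarN conjcM conjcK ![echar _ m]echarC.
  move: e3 ek; move: ((echar q a)^*) => cq e3 ek.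
  rewrite /x !ofdmE -/c0 conjcM c0J conjc_sum.
  rewrite (_ : c0 * _ * _ * _ = \sum_m (echar m (a - k) * z m 0)^* *
    \sum_m' c0 * c0 * cq * (echar m' a * z m' 0)); last first.
    by rewrite -mulr_suml -mulr_sumr; ring.
  apply: eq_bigr => m _; rewrite mulr_sumr; apply: eq_bigr => m' _.
  by rewrite e3 conjcM ek; ring.
rewrite exchange_big; apply: eq_bigr => m _ /=.
rewrite exchange_big (bigD1 (m + q)) //= [X in _ + X]big1 ?addr0.
  rewrite -mulr_sumr sum_echar -[m + q - m - q]addrA -opprD subrr eqxx mulr1.
  by rewrite -[RHS]mulr1 -[X in _ = _ * X]c0N; ring.
move=> m' mm'; rewrite -mulr_sumr sum_echar.
by rewrite -addrA -opprD subr_eq0 (negbTE mm') !mulr0.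
Qed.

End AmbiguityFormula.

(** * Contiguous Zadoff-Chu pilots *)

(** The bound is required for nonempty windows only: an empty one may start beyond [N]. *)
Lemma sum_ord_window (V : nmodType) (F : nat -> V) (a M N : nat) :
  ((0 < M)%N -> (a + M <= N)%N) ->
  \sum_(m < N | (a <= m < a + M)%N) F m = \sum_(l < M) F (a + l)%N.
Proof.
move=> aM; have [->|M0] := posnP M.
  by rewrite big_ord0 big_pred0// => m; lia.
rewrite -(big_mkord (fun m => (a <= m < a + M)%N)).
rewrite -(big_mkord xpredT (fun l => F (a + l)%N)).
have aMN := aM M0.
rewrite (big_cat_nat (n := a))//=; last by lia.
rewrite big_nat_cond big_pred0 ?add0r; last by move=> m; lia.
rewrite (big_cat_nat (n := (a + M)%N))//=; last by lia.
rewrite [X in _ + X]big_nat_cond [X in _ + X]big_pred0 ?addr0; last by move=> m; lia.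
transitivity (\sum_(0 + a <= m < a + M | (a <= m < a + M)%N) F m).
  by rewrite add0n.
rewrite big_addn addKn big_nat_cond [RHS]big_nat_cond.
by apply: eq_big => [m|m _]; [lia|rewrite addnC].
Qed.

Lemma card_contiguous (N i0 L : nat) : (i0 + L <= N)%N -> #|contiguous N i0 L| = L.
Proof.
move=> iL; rewrite -sum1_card.
transitivity (\sum_(m < N | (i0 <= m < i0 + L)%N) 1)%N.
  by apply: eq_bigl => m; rewrite inE.
by rewrite (sum_ord_window (fun=> 1%N)) ?sum1_card ?card_ord.
Qed.

Lemma val_ord_add (n : nat) (m q : 'I_n.+1) :
  (m + q)%R = (if m + q < n.+1 then m + q else m + q - n.+1)%N :> nat.
Proof.
rewrite /=; case: ltnP => mq; first by rewrite modn_small.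
have [mn qn] := (ltn_ord m, ltn_ord q).
rewrite -{1}(subnK mq) modnDr modn_small//; lia.
Qed.

(** * Overlap of the pilot set with its cyclic translate *)

Section PilotOverlap.
Context (n i0 L : nat) (q : 'I_n.+1).
Hypotheses (q0 : q != 0) (hL : (i0 + L <= n.+1)%N).
Local Notation N := n.+1.
Local Notation I := (contiguous N i0 L).

Definition overlap : {set 'I_N} := [set m | (m \in I) && (m + q \in I)]%SET.

(** The first run consists of the [m] for which [m + q] does not wrap around, the second of those
    for which it does. Truncated subtraction makes a run empty when its shift, [q] or [N - q], is at
    least [L]. *)
Lemma overlapE (m : 'I_N) : (m \in overlap) =
  (i0 <= m < i0 + (L - q))%N
  || (i0 + (N - q) <= m < i0 + (N - q) + (L - (N - q)))%N.
Proof.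
have [mn qn] := (ltn_ord m, ltn_ord q).
have q1 : (0 < q)%N by rewrite lt0n.
rewrite !inE val_ord_add; case: ifP => mq; lia.
Qed.

Lemma sum_overlap (V : nmodType) (F : 'I_N -> V) :
  \sum_(m in overlap) F m =
  \sum_(m < N | (i0 <= m < i0 + (L - q))%N) F m
  + \sum_(m < N | (i0 + (N - q) <= m < i0 + (N - q) + (L - (N - q)))%N) F m.
Proof.
rewrite (bigID (fun m : 'I_N => (i0 <= m < i0 + (L - q))%N)) /=.
congr (_ + _); apply: eq_bigl => m; rewrite overlapE; have := ltn_ord m; lia.
Qed.

Lemma card_overlap : #|overlap| = (L - q + (L - (N - q)))%N.
Proof.
have qn := ltn_ord q.
rewrite -sum1_card sum_overlap !(sum_ord_window (fun=> 1%N)) ?sum1_card ?card_ord//; lia.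
Qed.

End PilotOverlap.

(** * The pilot part as a sum of two Dirichlet kernels *)

Section ZadoffChu.
Context (R : realType) (n i0 L : nat) (u : int) (k q : 'I_n.+1).
Local Notation "z ^*" := (conjc z) : ring_scope.
Local Notation N := n.+1.
Hypotheses (q0 : q != 0) (L0 : (0 < L)%N) (hL : (i0 + L <= N)%N).

Let p (i : 'I_N) : R[i] := zadoff_chu R L u (i - i0).
Let term (m : 'I_N) : R[i] := echar R m k * ((p m)^* * p (m + q)).

(** On each run the summands form a geometric sequence: [theta1] and [theta2] are the frequencies,
    [phase1] and [phase2] the arguments of the first terms, at [i0] and at [i0 + (N - q)]. *)
Definition theta1 : R := k%:R / N%:R - u%:~R * q%:R / L%:R.
Definition theta2 : R := k%:R / N%:R - u%:~R * q%:R / L%:R + u%:~R * N%:R / L%:R.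
Definition phase1 : R :=
  2 * pi * i0%:R * k%:R / N%:R - pi * u%:~R * (q%:R ^+ 2 + q%:R) / L%:R.
Definition phase2 : R :=
  2 * pi * (i0%:R + (N%:R - q%:R)) * k%:R / N%:R
  + pi * u%:~R * ((N%:R - q%:R) ^+ 2 + (N%:R - q%:R)) / L%:R.

Let NR0 : (N%:R : R) != 0. Proof. by rewrite pnatr_eq0. Qed.
Let LR0 : (L%:R : R) != 0. Proof. by rewrite pnatr_eq0 -lt0n. Qed.

(** With [l = m - i0], the difference of [(l + q) * (l + q + 1)] and [l * (l + 1)] is
    [2 * l * q + q ^ 2 + q], so the exponent is affine in [l]. *)
Lemma term_window1 (m : 'I_N) : (i0 <= m < i0 + (L - q))%N ->
  term m = expi (phase1 + 2 * pi * theta1 * (m%:R - i0%:R)).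
Proof.
move=> mw; have mqN : (m + q < N)%N by lia.
rewrite /term /p /zadoff_chu val_ord_add mqN -expiN opprK /echar -!expiD.
rewrite !natrB ?natrD; [|lia..].
congr expi; rewrite /phase1 /theta1.
move: (N%:R : R) NR0 (L%:R : R) LR0 => N' N'0 L' L'0.
by field; rewrite N'0 L'0.
Qed.

Lemma term_window2 (m : 'I_N) :
  (i0 + (N - q) <= m < i0 + (N - q) + (L - (N - q)))%N ->
  term m = expi (phase2 + 2 * pi * theta2 * (m%:R - (i0 + (N - q))%N%:R)).
Proof.
move=> mw; have mqN : (m + q < N)%N = false by lia.
have qN := ltn_ord q.
rewrite /term /p /zadoff_chu val_ord_add mqN -expiN opprK /echar -!expiD.
rewrite !natrB ?natrD ?natrB; [|lia..].
congr expi; rewrite /phase2 /theta2.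
move: (N%:R : R) NR0 (L%:R : R) LR0 => N' N'0 L' L'0.
by field; rewrite N'0 L'0.
Qed.

Lemma sum_expi_window (a M : nat) (phase th : R) (F : 'I_N -> R[i]) :
  ((0 < M)%N -> (a + M <= N)%N) ->
  (forall m : 'I_N, (a <= m < a + M)%N ->
    F m = expi (phase + 2 * pi * th * (m%:R - a%:R))) ->
  \sum_(m < N | (a <= m < a + M)%N) F m =
  expi (phase + pi * th * (M%:R - 1)) * (dirichlet M th)%:C.
Proof.
move=> aM FE; rewrite (eq_bigr _ FE).
rewrite (sum_ord_window (fun m => expi (phase + 2 * pi * th * (m%:R - a%:R))))//.
rewrite expiD -[RHS]mulrA -sum_expi mulr_sumr; apply: eq_bigr => l _.
by rewrite -expiD natrD addrAC subrr add0r.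
Qed.

Lemma sum_overlap_zadoff_chu : \sum_(m in overlap i0 L q) term m =
  expi (phase1 + pi * theta1 * ((L - q)%N%:R - 1)) * (dirichlet (L - q) theta1)%:C
  + expi (phase2 + pi * theta2 * ((L - (N - q))%N%:R - 1))
    * (dirichlet (L - (N - q)) theta2)%:C.
Proof.
rewrite sum_overlap//; congr (_ + _).
  by apply: sum_expi_window; [lia|exact: term_window1].
by apply: sum_expi_window; [have := ltn_ord q; lia|exact: term_window2].
Qed.

Lemma cmod_expi_real (x y : R) : cmod (expi x * y%:C) ^+ 2 = y ^+ 2.
Proof. by rewrite cmodM cmod_expi mul1r cmod2E /= expr0n addr0. Qed.

Lemma dirichlet0 (th : R) : dirichlet 0 th = 0.
Proof. by rewrite /dirichlet big_ord0. Qed.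

Lemma cmod_overlap1 : (q + L <= N)%N ->
  cmod (\sum_(m in overlap i0 L q) term m) ^+ 2 = dirichlet (L - q) theta1 ^+ 2.
Proof.
move=> qL; rewrite sum_overlap_zadoff_chu (_ : (L - (N - q))%N = 0%N); last by lia.
by rewrite dirichlet0 mulr0 addr0 cmod_expi_real.
Qed.

Lemma cmod_overlap2 : (L <= q)%N ->
  cmod (\sum_(m in overlap i0 L q) term m) ^+ 2
  = dirichlet (L - (N - q)) theta2 ^+ 2.
Proof.
move=> qL; rewrite sum_overlap_zadoff_chu (_ : (L - q)%N = 0%N); last by lia.
by rewrite dirichlet0 mulr0 add0r cmod_expi_real.
Qed.

Lemma cmod_overlap12 : (N < q + L)%N -> (q < L)%N ->
  cmod (\sum_(m in overlap i0 L q) term m) ^+ 2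
  = (dirichlet (L - q) theta1
     + (-1) ^ (k%:Z - u * N%:Z) * dirichlet (L - (N - q)) theta2) ^+ 2.
Proof.
move=> qL Lq; have qN := ltn_ord q; rewrite sum_overlap_zadoff_chu.
(* The mean phases of the two runs differ by [pi * (k - u * N)] up to a multiple of [2 * pi]. The
   common phase drops out of the modulus, leaving a real combination with a sign. *)
have -> : phase2 + pi * theta2 * ((L - (N - q))%N%:R - 1) =
    (phase1 + pi * theta1 * ((L - q)%N%:R - 1))
    + pi * (k%:Z - u * N%:Z)%:~R + 2 * pi * (u * N%:Z)%:~R.
  rewrite !natrB; [|lia..]; rewrite rmorphB !rmorphM /= -!pmulrn.
  rewrite /phase1 /phase2 /theta1 /theta2.
  move: (N%:R : R) NR0 (L%:R : R) LR0 => N' N'0 L' L'0.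
  by field; rewrite N'0 L'0.
set phi := phase1 + _.
rewrite expiD expi_2pi_int mulr1 expiD expi_pi_int -mulrA -mulrDr.
rewrite -[LHS]/(cmod (_ * (_ + (-1) ^ _ * _)) ^+ 2).
rewrite -(rmorphN1 (real_complex R)) -fmorphXz -rmorphM -rmorphD.
exact: cmod_expi_real.
Qed.

End ZadoffChu.

(** The quotient and the limit branch of the definition are both values of the same kernel. *)
Lemma g1E (R : realType) (N L : nat) (u : int) (k q : nat) :
  (k < N)%N -> (q <= L)%N ->
  g1 R N L u k q = dirichlet (L - q) (k%:R / N%:R - u%:~R * q%:R / L%:R).
Proof.
move=> kN qL; rewrite /g1 -natrB//.
have N0 : (N%:R : R) != 0 by rewrite pnatr_eq0; lia.
set x := _ * N%:R / L%:R.
have -> : u%:~R * q%:R / L%:R = x / N%:R :> R.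
  by rewrite /x [RHS]mulrAC mulfK.
case: ifPn => [/(natr_eq_rmod x kN)[z ->]|kx]; first exact: sinratio_limE.
apply: sinratioE; apply: contraNN kx => /eqP /sin_pi_eq0 zE.
exact/(natr_eq_rmod x kN).
Qed.

Lemma g2E (R : realType) (N L : nat) (u : int) (k q : nat) :
  (k < N)%N -> (q <= N)%N -> (N - q <= L)%N ->
  g2 R N L u k q = dirichlet (L - (N - q))
    (k%:R / N%:R - u%:~R * q%:R / L%:R + u%:~R * N%:R / L%:R).
Proof.
move=> kN qN qL; rewrite /g2.
have -> : L%:R - N%:R + q%:R = (L - (N - q))%N%:R :> R.
  by rewrite !natrB// opprB addrA addrAC.
have N0 : (N%:R : R) != 0 by rewrite pnatr_eq0; lia.
set x := _ * N%:R / L%:R.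
have -> : k%:R / N%:R - u%:~R * q%:R / L%:R + u%:~R * N%:R / L%:R
    = k%:R / N%:R - x / N%:R :> R.
  have -> : x / N%:R = u%:~R * (q%:R - N%:R) / L%:R by rewrite /x mulrAC mulfK.
  by ring.
case: ifPn => [/(natr_eq_rmod x kN)[z ->]|kx]; first exact: sinratio_limE.
apply: sinratioE; apply: contraNN kx => /eqP /sin_pi_eq0 zE.
exact/(natr_eq_rmod x kN).
Qed.

(** * Mean power of the ambiguity function *)

Section Power.
Context (R : realType) (d d' : measure_display) (T : measurableType d)
  (T' : measurableType d') (P : probability T R) (Q : probability T' R)
  (D : T' -> R[i]) (n L i0 : nat) (u : int) (s : T -> 'cV[R[i]]_n.+1).
Local Notation N := n.+1.
Local Notation pilot := (fun i : 'I_N => zadoff_chu R L u (i - i0)).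
Hypotheses (hL : (i0 + L <= N)%N) (hD : data_symbol Q D)
  (hs : symbol_vector P Q D (contiguous N i0 L) pilot s).
Variables k q : 'I_N.
Local Notation power := ('E_P[fun t => (cmod (dpaf (ofdm (s t)) k q) ^+ 2)%R])%E.

Let pilot_unit (i : 'I_N) : i \in contiguous N i0 L ->
  conjc (pilot i) * pilot i = 1.
Proof. by rewrite expiJM. Qed.

Let echar_unit (i : 'I_N) : conjc (echar R i k) * echar R i k = 1.
Proof. exact: expiJM. Qed.

Lemma power_q0 : q = 0 -> power =
  (N%:R ^+ 2 * (k == 0)%:R + (kurtosis Q D - 1) * (N%:R - L%:R))%:E.
Proof.
move=> q0; have [_] := has_expect_power0 hD hs pilot_unit echar_unit.
have -> : \sum_m echar R m k = N%:R * (k == 0)%:R.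
  by rewrite -sum_echar; apply: eq_bigr => m _; rewrite echarC.
rewrite card_contiguous//.
have -> : cmod (N%:R * (k == 0)%:R : R[i]) ^+ 2 = N%:R ^+ 2 * (k == 0)%:R.
  rewrite -natrM cmod2E -[_%:R](rmorph_nat (real_complex R)) /= expr0n addr0.
  by rewrite natrM exprMn; case: (k == 0); rewrite ?expr1n ?expr0n.
move=> <-; rewrite [in LHS]unlock; apply: eq_integral => t _; rewrite dpaf_ofdm q0.
by under eq_bigr do rewrite addr0.
Qed.

Lemma power_overlap : q != 0 -> power =
  (cmod (\sum_(m in overlap i0 L q)
     echar R m k * (conjc (pilot m) * pilot (m + q)))
   ^+ 2 + (N%:R - (L - q + (L - (N - q)))%N%:R))%:E.
Proof.
move=> q0; rewrite -(card_overlap q0 hL).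
have ovE m : (m \in overlap i0 L q) =
    (m \in contiguous N i0 L) && (m + q \in contiguous N i0 L) by rewrite inE.
have [_ <-] := has_expect_power hD hs pilot_unit echar_unit q0 ovE.
by rewrite [in LHS]unlock; apply: eq_integral => t _; rewrite dpaf_ofdm.
Qed.

End Power.

Theorem proposition4 (R : realType)
    (d d' : measure_display) (T : measurableType d) (T' : measurableType d')
    (P : probability T R) (Q : probability T' R) (D : T' -> R[i])
    (N L i0 : nat) (u : int) (s : T -> 'cV[R[i]]_N)
    (hLodd : odd L) (hL : (1 <= L <= N)%N) (hi0 : (i0 <= N - L)%N)
    (hD : data_symbol Q D)
    (hs : symbol_vector P Q D (contiguous N i0 L)
            (fun i : 'I_N => zadoff_chu R L u (i - i0)) s)
    (k q : 'I_N) :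
  let kappa := kurtosis Q D in
  let g1 := g1 R N L u k q in
  let g2 := g2 R N L u k q in
  let power := ('E_P[fun t => (cmod (dpaf (ofdm (s t)) k q) ^+ 2)%R])%E in
  ((2 * L <= N)%N ->
    [/\ q = 0%N :> nat ->
          power = (N%:R ^+ 2 * (k == 0%N :> nat)%:R
                   + (kappa - 1) * (N%:R - L%:R))%:E,
        (1 <= q < L)%N ->
          power = (g1 ^+ 2 - L%:R + q%:R + N%:R)%:E,
        (L <= q <= N - L)%N ->
          power = (N%:R)%:E
      & (N - L < q < N)%N ->
          power = (g2 ^+ 2 - L%:R - q%:R + 2 * N%:R)%:E])
  /\
  ((N < 2 * L)%N ->
    [/\ q = 0%N :> nat ->
          power = (N%:R ^+ 2 * (k == 0%N :> nat)%:R
                   + (kappa - 1) * (N%:R - L%:R))%:E,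
        (1 <= q <= N - L)%N ->
          power = (g1 ^+ 2 - L%:R + q%:R + N%:R)%:E,
        (N - L < q < L)%N ->
          power = ((g1 + (-1) ^ (k%:Z - u * N%:Z) * g2) ^+ 2
                   + 2 * N%:R - 2 * L%:R)%:E
      & (L <= q < N)%N ->
          power = (g2 ^+ 2 - L%:R - q%:R + 2 * N%:R)%:E]).
Proof.
(* [N = 0] leaves no index [k]; a successor gives ['I_N] its ring structure. *)
case: N s i0 hi0 hL hs k q => [|n] {}s {}i0 {}hi0 {}hL {}hs {}k {}q; first by case: k.
case/andP: hL => L0 LN.
have hL : (i0 + L <= n.+1)%N by lia.
have [kN qN] := (ltn_ord k, ltn_ord q).
move=> kappa gg1 gg2 power.
have q0E : (q = 0%N :> nat) -> power = (n.+1%:R ^+ 2 * (k == 0%N :> nat)%:R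
    + (kappa - 1) * (n.+1%:R - L%:R))%:E.
  by move=> q0; apply: (power_q0 hL hD hs k); apply: val_inj.
have qn0 : (0 < q)%N -> q != 0 by rewrite lt0n.
have powerE : (0 < q)%N -> power = (cmod (\sum_(m in overlap i0 L q)
      echar R m k * (conjc (zadoff_chu R L u (m - i0))
        * zadoff_chu R L u ((m + q)%R - i0))) ^+ 2
    + (n.+1%:R - (L - q + (L - (n.+1 - q)))%N%:R))%:E.
  by move=> q0; apply: (power_overlap hL hD hs k (qn0 q0)).
(* Here no pair of pilots wraps around: only the first run can be nonempty. *)
have case1 : (0 < q)%N -> (q <= L)%N -> (q + L <= n.+1)%N ->
    power = (gg1 ^+ 2 - L%:R + q%:R + n.+1%:R)%:E.
  move=> q0 qL qLN; rewrite powerE// (cmod_overlap1 R u k (qn0 q0) L0 hL)//.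
  rewrite /gg1 g1E// (_ : (L - (n.+1 - q))%N = 0%N) ?addn0; last by lia.
  by rewrite natrB//; congr (_%:E); rewrite /theta1; ring.
(* Here the shift is at least [L]: only the wrapped run can be nonempty. *)
have case2 : (0 < q)%N -> (L <= q)%N -> (n.+1 <= q + L)%N ->
    power = (gg2 ^+ 2 - L%:R - q%:R + 2 * n.+1%:R)%:E.
  move=> q0 qL qLN; rewrite powerE// (cmod_overlap2 R u k (qn0 q0) L0 hL)//.
  rewrite /gg2 g2E//; [|lia..].
  rewrite (_ : (L - q)%N = 0%N) ?add0n; last by lia.
  rewrite !natrB//; [|lia..].
  by congr (_%:E); rewrite /theta2; ring.
split=> LN2; split => //.
- by move=> ?; apply: case1; lia.
(* Both runs are empty, so the pilot part is 0 and all [N] terms are counted. *)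
- move=> ?; have q0 : (0 < q)%N by lia.
  rewrite powerE// (cmod_overlap1 R u k (qn0 q0) L0 hL)//; last by lia.
  rewrite (_ : (L - q)%N = 0%N) ?add0n; last by lia.
  rewrite (_ : (L - (n.+1 - q))%N = 0%N) ; last by lia.
  by rewrite dirichlet0 expr0n add0r subr0.
- by move=> ?; apply: case2; lia.
- by move=> ?; apply: case1; lia.
(* Both runs are nonempty and interfere; together they have [2 * L - N] elements. *)
- move=> ?; have q0 : (0 < q)%N by lia.
  rewrite powerE// (cmod_overlap12 R u k (qn0 q0) L0 hL)//; [|lia..].
  rewrite /gg1 /gg2 g1E ?g2E//; [|lia..].
  rewrite natrD !natrB//; [|lia..].
  by congr (_%:E); rewrite /theta1 /theta2; ring.
- by move=> ?; apply: case2; lia.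
Qed.
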